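(* Let $r \geq 3$ and let $u = \lceil r/2 \rceil$. Then (i) $\theta(\mathrm{TK}^r_{r+2}) \geq 2^{-\binom{ur}{2} + r\binom{u}{2}}\, r^{-r}$, i.e. $\mathrm{RT}(n,\mathrm{TK}^r_{r+2},o(n)) \geq 2^{-\binom{ur}{2} + r\binom{u}{2}}\left(\frac{n}{r}\right)^r$; (ii) $\theta(\mathcal{TK}^r_{2r}) \geq 2^{-\binom{ur}{2} + r\binom{u}{2}}\, r^{-r}$, i.e. $\mathrm{RT}(n,\mathcal{TK}^r_{2r},o(n)) \geq 2^{-\binom{ur}{2} + r\binom{u}{2}}\left(\frac{n}{r}\right)^r$.
   Context: All hypergraphs are $r$-uniform. The independence number of a hypergraph is the maximum size of a vertex set containing no hyperedge. For an $r$-uniform hypergraph $\mathcal{H}$ (or a family of them) and a function $f$, $\mathrm{RT}(n,\mathcal{H},f(n))$ is the maximum number of hyperedges in an $n$-vertex $r$-uniform hypergraph containing no (member of) $\mathcal{H}$ as a subhypergraph and having independence number at most $f(n)$. Define $\theta(\mathcal{H}) = \lim_{\epsilon\to0}\lim_{n\to\infty}\mathrm{RT}(n,\mathcal{H},\epsilon n)/n^r$; the notation $\mathrm{RT}(n,\mathcal{H},o(n)) \ge c n^r$ means $\theta(\mathcal{H})\ge c$. For $s>r$, $\mathrm{TK}^r_s$ is the $r$-uniform hypergraph obtained from $K_s$ by replacing each edge $uv$ with a hyperedge consisting of $u$, $v$ and $r-2$ new vertices (distinct for different edges). $\mathcal{TK}^r_s$ is the family of $r$-uniform hypergraphs $\mathcal{F}$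 for which there is a set $S$ of $s$ vertices such that every pair of vertices of $S$ is contained in some hyperedge of $\mathcal{F}$. *)

(* Defs.v *)
From HB Require Import structures.
From mathcomp Require Import all_boot all_order all_algebra.
From mathcomp Require Import all_classical all_reals all_analysis.

Set Implicit Arguments.
Unset Strict Implicit.
Unset Printing Implicit Defensive.

Import Order.TTheory GRing.Theory Num.Theory.
Import numFieldNormedType.Exports.

Local Open Scope classical_set_scope.
Local Open Scope ring_scope.

(* A hypergraph on the vertex set V is given by its set of hyperedges. *)
Definition hypergraph (V : finType) := {set {set V}}.

Definition uniform (r : nat) (V : finType) (G : hypergraph V) : bool :=
  [forall e in G, #|e| == r].

Definition independence_number (V : finType) (G : hypergraph V) : nat :=
  \max_(A : {set V} | [forall e in G, ~~ (e \subset A)]) #|A|.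

(* Not necessarily induced containment, up to relabelling of the vertices. *)
Definition contains (U V : finType) (G : hypergraph V) (F : hypergraph U) :=
  exists f : U -> V,
    injective f /\ (forall e : {set U}, e \in F -> f @: e \in G).

(* A family of hypergraphs; the members may have any finite vertex sets. *)
Definition family := forall V : finType, hypergraph V -> Prop.

Definition family_free (H : family) (V : finType) (G : hypergraph V) :=
  forall (U : finType) (F : hypergraph U), H U F -> ~ contains G F.

(* Ramsey-Turan number of r-uniform hypergraphs: the independence number is
   bounded by a real number a, and the vertex set of an n-vertex hypergraph is
   taken to be 'I_n. The maximum over no hypergraph is 0. *)
Definition RT (R : realType) (r n : nat) (H : family) (a : R) : nat :=
  \max_(G : hypergraph 'I_n |
      `[< [/\ uniform r G, family_free H G
            & (independence_number G)%:R <= a] >]) #|G|.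

Definition RT_ratio (R : realType) (r : nat) (H : family) (eps : R) (n : nat)
    : R :=
  (RT r n H (eps * n%:R))%:R / n%:R ^+ r.

(* theta(H) is the limit as eps -> 0+ of the limit as n -> oo of
   RT(n, H, eps n) / n^r. For a fixed eps > 0 the convergence in n is not clear
   for an arbitrary family, so the inner limit is taken to be the lower limit,
   which is the limit whenever it exists (theta_lim below). The outer limit
   always exists, by monotonicity in eps (is_cvg_theta below). *)
Definition theta (R : realType) (r : nat) (H : family) : \bar R :=
  lim (limn_einf (fun n => (RT_ratio r H eps n)%:E) @[eps --> (0 : R)^'+]).

(* The vertices of TK^r_s are the s core vertices together with, for each pair
   i < j of core vertices, the r - 2 new vertices (i, j, k), k < r - 2. *)
Definition core_pair (s : nat) := {p : 'I_s * 'I_s | (p.1 < p.2)%N}.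

Definition TK_vertex (r s : nat) : finType :=
  ('I_s + core_pair s * 'I_(r - 2))%type.

Definition TK_edge (r s : nat) (p : core_pair s) : {set TK_vertex r s} :=
  [set inl (val p).1; inl (val p).2] :|: [set inr (p, k) | k : 'I_(r - 2)].

Definition TK (r s : nat) : hypergraph (TK_vertex r s) :=
  [set TK_edge r p | p : core_pair s].

(* The family whose only member is TK^r_s. *)
Variant TK_single (r s : nat) : family :=
  | In_TK_single : @TK_single r s (TK_vertex r s) (TK r s).

Definition TK_family (r s : nat) : family :=
  fun V F => uniform r F /\
    exists S : {set V}, #|S| = s /\
      {in S &, forall x y, x != y ->
         exists2 e, e \in F & (x \in e) && (y \in e)}.

Lemma TK_uniform (r s : nat) : (2 <= r)%N -> uniform r (TK r s).
Proof.
move=> r2; apply/forall_inP => e /imsetP[p _ ->]; apply/eqP.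
rewrite /TK_edge cardsU disjoint_setI0 ?cards0 ?subn0; last first.
  apply/pred0P => -[x|x] /=; rewrite !inE; first last.
    by [].
  by apply/negbTE/negP => /andP[_ /imsetP[k _]].
rewrite cards2 card_imset; last by move=> i j [].
rewrite card_ord.
have -> : (inl (val p).1 : TK_vertex r s) != inl (val p).2.
  by apply/eqP => -[] eq12; have := valP p; rewrite eq12 ltnn.
by rewrite subnKC.
Qed.

Lemma RT_le (R : realType) (r n : nat) (H : family) (a b : R) :
  a <= b -> (RT r n H a <= RT r n H b)%N.
Proof.
move=> ab; apply/bigmax_leqP => G /asboolP[u f i].
by apply: leq_bigmax_cond; apply/asboolP; split=> //; exact: le_trans ab.
Qed.

Lemma is_cvg_theta (R : realType) (r : nat) (H : family) :
  cvg (limn_einf (fun n => (RT_ratio r H eps n)%:E) @[eps --> (0 : R)^'+]).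
Proof.
apply: nondecreasing_at_right_is_cvge; near=> e => x y _ _ xy.
rewrite !limn_einf_lim; apply: lee_lim; [exact: is_cvg_einfs..|].
apply: nearW => n; apply: le_ereal_inf_tmp => _ [m nm <-].
apply: (@le_trans _ _ (RT_ratio r H x m)%:E).
  by apply: ereal_inf_lbound; exists m.
rewrite lee_fin ler_wpM2r ?invr_ge0 ?exprn_ge0 ?ler0n// ler_nat RT_le//.
by rewrite ler_wpM2r.
Unshelve. all: by end_near. Qed.

Lemma theta_lim (R : realType) (r : nat) (H : family) (L : R -> R) (t : R) :
  (\forall eps \near (0 : R)^'+, RT_ratio r H eps n @[n --> \oo] --> L eps) ->
  L eps @[eps --> (0 : R)^'+] --> t ->
  theta R r H = t%:E.
Proof.
move=> HL Lt; apply/cvg_lim => //.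
have {}Lt : (L eps)%:E @[eps --> (0 : R)^'+] --> t%:E.
  by apply: cvg_EFin => //; exact: nearW.
apply: cvg_trans Lt; apply: near_eq_cvg; near=> e.
have LE : RT_ratio r H e n @[n --> \oo] --> L e by near: e.
have {}LE : (RT_ratio r H e n)%:E @[n --> \oo] --> (L e)%:E.
  by apply: cvg_EFin => //; exact: nearW.
by rewrite (cvg_limn_einf_sup LE).1.
Unshelve. all: by end_near. Qed.

(* Main.v *)
(* The lower bound comes from an r-partite version of the Bollobas-Erdos graph.
   Vertices are points of a discrete cube; summing the signs in blocks of k bits
   maps the cube to vectors that behave like Gaussian ones.
   - Inside each part we put a sparse r-graph, without short cycles, whose
     edges consist of points any two of which are nearly antipodal in some
     coordinate.  By the Poincare inequality on the cube, r sets of positive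
     density have points at bounded distance from a common point, whatever the
     dimension; so every set of positive density contains such r points, and an
     edge if the r-graph is chosen greedily.
   - Across the parts we take all transversals such that, for i < j and each of
     u^2 coordinates, the inner product of the i-th and j-th points exceeds a
     constant.  The inner product is a random walk, which by a discrete Tanaka
     formula rarely stays in a bounded window; so each inequality has
     probability close to 1/2, and they are independent.
   Four large inner products between two nearly antipodal pairs are impossible,
   because their sum is the inner product of two short vectors.  So a core has at
   most one part with two or more of its vertices.  A part contains at most r
   vertices that are pairwise covered, and at most 2 core vertices of a TK^r_s,
   as three would span a triangle of edges.  This leaves at most 2r - 1,
   respectively r + 1, core vertices. *)
Require Import Defs.
From mathcomp Require Import all_boot all_order all_algebra.
From mathcomp Require Import all_classical all_reals all_analysis.
From mathcomp Require Import ring lra zify.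
Import Order.TTheory GRing.Theory Num.Theory.

Local Open Scope ring_scope.

Set Implicit Arguments.
Unset Strict Implicit.
Unset Printing Implicit Defensive.

(** * Anti-concentration of random walks *)

Definition avg (R : realType) (T : finType) (f : T -> R) : R :=
  (\sum_x f x) / #|T|%:R.

Section Avg.
Context {R : realType}.
Implicit Types T S : finType.

Lemma eq_avg T (f g : T -> R) : f =1 g -> avg f = avg g.
Proof. by move=> fg; congr (_ / _); apply: eq_bigr. Qed.

Lemma avgD T (f g : T -> R) : avg (fun x => f x + g x) = avg f + avg g.
Proof. by rewrite /avg big_split mulrDl. Qed.

Lemma avgZ T (a : R) (f : T -> R) : avg (fun x => a * f x) = a * avg f.
Proof. by rewrite /avg -mulr_sumr mulrA. Qed.

Lemma le_avg T (f g : T -> R) : (forall x, f x <= g x) -> avg f <= avg g.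
Proof. by move=> fg; rewrite ler_wpM2r ?invr_ge0 ?ler0n ?ler_sum. Qed.

Lemma avg_ge0 T (f : T -> R) : (forall x, 0 <= f x) -> 0 <= avg f.
Proof. by move=> f0; rewrite divr_ge0 ?sumr_ge0. Qed.

Lemma avg_cst T (a : R) : (0 < #|T|)%N -> avg (fun _ : T => a) = a.
Proof.
move=> T0; by rewrite /avg sumr_const -[a *+ _]mulr_natr mulfK// pnatr_eq0 -lt0n.
Qed.

Lemma avg_sum T I (r : seq I) (F : I -> T -> R) :
  avg (fun x => \sum_(i <- r) F i x) = \sum_(i <- r) avg (F i).
Proof. by rewrite /avg exchange_big /= mulr_suml. Qed.

Lemma reindex_avg T S (h : S -> T) (f : T -> R) :
  bijective h -> avg f = avg (fun x => f (h x)).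
Proof.
move=> hbij; rewrite /avg (reindex h); last exact: onW_bij.
by rewrite (bij_eq_card hbij).
Qed.

Lemma avg_pair T S (f : T -> S -> R) :
  avg (fun z : T * S => f z.1 z.2) = avg (fun x => avg (f x)).
Proof.
rewrite /avg -mulr_suml pair_bigA /= card_prod natrM invfM.
by rewrite -mulrA [X in _ * X]mulrC.
Qed.

Lemma avg_mul T S (f : T -> R) (g : S -> R) :
  avg (fun z : T * S => f z.1 * g z.2) = avg f * avg g.
Proof.
rewrite (avg_pair (fun x y => f x * g y)) mulrC -avgZ.
by apply: eq_avg => x; rewrite avgZ mulrC.
Qed.

Lemma avg_pred T (P : pred T) :
  avg (fun x => (P x)%:R : R) = #|[set x | P x]|%:R / #|T|%:R.
Proof.
rewrite /avg -sum1_card natr_sum [in RHS]big_mkcond; congr (_ / _).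
by apply: eq_bigr => x _; rewrite inE; case: (P x).
Qed.

End Avg.

Section Walk.
Context {R : realType} (S : finType) (W : S -> R).
Implicit Types (F : R -> R) (d : nat).

Definition walk d (z : {ffun 'I_d -> S}) : R := \sum_i W (z i).

Lemma avg_walk0 F : avg (fun z => F (@walk 0 z)) = F 0.
Proof.
rewrite -[RHS](@avg_cst R {ffun 'I_0 -> S}); first last.
  by rewrite card_ffun card_ord.
by apply: eq_avg => z; rewrite /walk big_ord0.
Qed.

(** Conditioning on all but the last step reduces moments and local times to one step, by induction
    on [d]. *)
Lemma avg_walkS d F :
  avg (fun z => F (@walk d.+1 z)) =
  avg (fun z => avg (fun s => F (@walk d z + W s))).
Proof.
pose cons (p : {ffun 'I_d -> S} * S) : {ffun 'I_d.+1 -> S} :=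
  [ffun i => if unlift ord_max i is Some j then p.1 j else p.2].
have cons_bij : bijective cons.
  exists (fun z : {ffun 'I_d.+1 -> S} =>
    ([ffun i : 'I_d => z (lift ord_max i)], z ord_max)) => [[z s]|z].
    congr pair; last by rewrite ffunE unlift_none.
    by apply/ffunP => i; rewrite !ffunE liftK.
  by apply/ffunP => i; rewrite ffunE; case: unliftP => [j|] -> //; rewrite ffunE.
rewrite (reindex_avg _ cons_bij) -avg_pair.
apply: eq_avg => -[z s] /=; congr F; rewrite /walk big_ord_recr /=.
congr (_ + W _); last by rewrite ffunE unlift_none.
apply: eq_bigr => i _; rewrite ffunE.
have -> : widen_ord (leqnSn d) i = lift ord_max i.
  by apply: ord_inj; rewrite lift_max.
by rewrite liftK.
Qed.

Hypotheses (S0 : (0 < #|S|)%N).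
(** Symmetry of the step distribution, phrased through test functions so that no involution of [S]
    has to be exhibited. *)
Hypothesis W_sym : forall F, avg (fun s => F (- W s)) = avg (fun s => F (W s)).

Lemma avg_step1 : avg W = 0.
Proof.
have := W_sym id; rewrite (eq_avg (g := fun s => -1 * W s)); last first.
  by move=> s; rewrite mulN1r.
rewrite avgZ; lra.
Qed.

Lemma avg_step3 : avg (fun s => W s ^+ 3) = 0.
Proof.
have := W_sym (fun w => w ^+ 3).
rewrite (eq_avg (g := fun s => -1 * W s ^+ 3)); last by move=> s; ring.
rewrite avgZ; lra.
Qed.

Let avgS (a : R) : avg (fun _ : S => a) = a. Proof. exact: avg_cst. Qed.

Let avgW d (a : R) : avg (fun _ : {ffun 'I_d -> S} => a) = a.
Proof. by apply: avg_cst; rewrite card_ffun expn_gt0 S0. Qed.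

Lemma avg_walk_sqr d :
  avg (fun z => @walk d z ^+ 2) = d%:R * avg (fun s => W s ^+ 2).
Proof.
elim: d => [|d IH]; first by rewrite (avg_walk0 (fun w => w ^+ 2)) mul0r expr0n.
rewrite (avg_walkS d (fun w => w ^+ 2)).
transitivity (avg (fun z => @walk d z ^+ 2 + avg (fun s => W s ^+ 2))).
  apply: eq_avg => z.
  transitivity (avg (fun s =>
      walk z ^+ 2 + (2 * walk z * W s + W s ^+ 2))).
    by apply: eq_avg => s; ring.
  by rewrite !avgD avgZ avg_step1 avgS; ring.
by rewrite avgD avgW IH -[d.+1%:R]natr1; ring.
Qed.

(** The hypothesis compares the fourth moment of a step with that of a Gaussian of the same
    variance. Odd moments vanish by symmetry, and the remaining terms are the increments of
    [3 d^2 v^2]. *)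
Lemma avg_walk_pow4 d (v := avg (fun s => W s ^+ 2)) :
  avg (fun s => W s ^+ 4) <= 3 * v ^+ 2 ->
  avg (fun z => @walk d z ^+ 4) <= 3 * d%:R ^+ 2 * v ^+ 2.
Proof.
move=> W4; elim: d => [|d IH].
  by rewrite (avg_walk0 (fun w => w ^+ 4)) !expr0n /=; lra.
rewrite (avg_walkS d (fun w => w ^+ 4)).
have -> : avg (fun z => avg (fun s => (@walk d z + W s) ^+ 4)) =
    avg (fun z => @walk d z ^+ 4 + (6 * v * walk z ^+ 2 + avg (fun s => W s ^+ 4))).
  apply: eq_avg => z.
  transitivity (avg (fun s =>
      walk z ^+ 4 + (4 * walk z ^+ 3 * W s + (6 * walk z ^+ 2 * W s ^+ 2 +
      (4 * walk z * W s ^+ 3 + W s ^+ 4))))).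
    by apply: eq_avg => s; ring.
  by rewrite !avgD !avgZ avg_step1 avg_step3 avgS /v; ring.
rewrite !avgD avgZ avgW avg_walk_sqr -/v -[d.+1%:R]natr1.
have -> : 3 * (d%:R + 1) ^+ 2 * v ^+ 2 =
  3 * d%:R ^+ 2 * v ^+ 2 + (6 * v * (d%:R * v) + 3 * v ^+ 2) by ring.
by rewrite lerD// lerD.
Qed.

(* Discrete Tanaka formula: the local time at [a] is paid for by the growth of
   [E|Z_d - a|], which is at most [E|Z_D| = O(sqrt D)]. *)
Lemma avg_walk_tanaka d (a m : R) :
  2 * m <= avg (fun s => `|W s|) ->
  avg (fun z => `|@walk d z - a|) +
    m * avg (fun z => (`|@walk d z - a| <= m)%R%:R)
  <= avg (fun z => `|@walk d.+1 z - a|).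
Proof.
move=> Wm; rewrite (avg_walkS d (fun w => `|w - a|)) -avgZ -avgD.
apply: le_avg => z; set x := walk z - a.
(* When a step is paired with its negative, [|x + w| + |x - w|] is at least both [2 |x|] and
   [2 |w|]: the second bound serves inside the window, the first outside. *)
have half (F : R -> R) : avg (fun s => F (x + W s)) =
    avg (fun s => 2^-1 * (F (x + W s) + F (x - W s))).
  rewrite avgZ avgD (W_sym (fun w => F (x + w))); lra.
have -> : avg (fun s => `|walk z + W s - a|) = avg (fun s => `|x + W s|).
  by apply: eq_avg => s; rewrite addrAC.
rewrite (half (fun w => `|w|)).
case: (leP `|x| m) => [xm|_]; rewrite ?mulr1 ?mulr0 ?addr0; last first.
  rewrite -[leLHS]avgS; apply: le_avg => s.
  rewrite ler_pdivlMl// -[2]gtr0_norm// -normrM.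
  have -> : 2 * x = (x + W s) + (x - W s) by ring.
  exact: ler_normD.
apply: le_trans (_ : 2 * m <= _); first lra.
apply: le_trans Wm _; apply: le_avg => s.
rewrite ler_pdivlMl// -[2]gtr0_norm// -normrM.
have -> : 2 * W s = (x + W s) - (x - W s) by ring.
exact: ler_normB.
Qed.

Lemma sum_avg_walk_small e (a m : R) :
  2 * m <= avg (fun s => `|W s|) ->
  m * \sum_(d < e) avg (fun z => (`|@walk d z - a| <= m)%R%:R)
  <= avg (fun z => `|@walk e z|).
Proof.
(* The Tanaka inequalities telescope from [E|Z_0 - a| = |a|]; the triangle inequality then removes
   [|a|] from both sides. *)
move=> Wm; suff : `|a| + m * \sum_(d < e) avg (fun z => (`|@walk d z - a| <= m)%R%:R)
    <= avg (fun z => `|@walk e z - a|).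
  have : avg (fun z => `|@walk e z - a|) <= avg (fun z => `|@walk e z| + `|a|).
    by apply: le_avg => z; apply: ler_normB.
  rewrite avgD avgW; lra.
elim: e => [|e IH].
  by rewrite big_ord0 (avg_walk0 (fun w => `|w - a|)) sub0r normrN mulr0 addr0.
rewrite big_ord_recr /= mulrDr addrA.
by apply: le_trans (avg_walk_tanaka e a Wm); rewrite lerD2r.
Qed.

End Walk.

Section WalkWindow.
Context {R : realType} (S : finType) (W : S -> R).
Hypotheses (S0 : (0 < #|S|)%N).
Hypothesis W_sym : forall F : R -> R,
  avg (fun s => F (- W s)) = avg (fun s => F (W s)).

Lemma avg_walk_sym d (F : R -> R) :
  avg (fun z => F (- @walk R S W d z)) = avg (fun z => F (@walk R S W d z)).
Proof.
elim: d F => [|d IH] F.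
  by rewrite (avg_walk0 _ (fun w => F (- w))) avg_walk0 oppr0.
rewrite (avg_walkS W d (fun w => F (- w))) avg_walkS.
rewrite -(IH (fun w => avg (fun s => F (w + W s)))).
apply: eq_avg => z; rewrite -(W_sym (fun w => F (- walk W z + w))).
by apply: eq_avg => s; rewrite opprD.
Qed.

(** A window is covered by two of half its radius, centred at [a + t] and [a - t], so each doubling
    of the radius doubles the bound. *)
Lemma sum_avg_walk_window e p (a m : R) : 0 <= m ->
  2 * m <= avg (fun s => `|W s|) ->
  m * \sum_(d < e) avg (fun z => (`|@walk R S W d z - a| <= 2 ^+ p * m)%R%:R)
  <= 2 ^+ p * avg (fun z => `|@walk R S W e z|).
Proof.
move=> m0 Wm; elim: p a => [|p IH] a.
  by rewrite expr0 !mul1r; exact: sum_avg_walk_small.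
pose t := 2 ^+ p * m.
apply: (@le_trans _ _ (m * \sum_(d < e)
   (avg (fun z => (`|@walk R S W d z - (a + t)| <= t)%R%:R) +
    avg (fun z => (`|@walk R S W d z - (a - t)| <= t)%R%:R)))).
  rewrite ler_wpM2l// ler_sum// => d _; rewrite -avgD; apply: le_avg => z.
  set x := walk W z; rewrite exprS -mulrA -/t.
  case: (leP `|x - a| _) => [xa|_]; last by rewrite addr_ge0 ?ler0n.
  have [xt|xt] := leP `|x - (a + t)| t; first by rewrite lerDl ler0n.
  have -> : `|x - (a - t)| <= t; last by rewrite lerDr ler0n.
  have := xt; rewrite ltNge ler_norml negb_and -!ltNge.
  by move: xa; rewrite !ler_norml; case/andP=> ? ? /orP[]?; apply/andP; split; lra.
have -> : 2 ^+ p.+1 = 2 ^+ p + 2 ^+ p :> R by rewrite exprS; ring.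
rewrite big_split mulrDl mulrDr; exact: (lerD (IH _) (IH _)).
Qed.

End WalkWindow.

(** * Inner products of random block-sum vectors *)

Definition sgb (R : realType) (b : bool) : R := (-1) ^+ b.

Lemma sgb_neg (R : realType) b : sgb R (~~ b) = - sgb R b.
Proof. by rewrite /sgb; case: b; rewrite ?expr0 ?expr1 ?opprK. Qed.

Lemma sgb_sym (R : realType) (F : R -> R) :
  avg (fun b => F (- sgb R b)) = avg (fun b => F (sgb R b)).
Proof.
rewrite [RHS](@reindex_avg _ _ _ negb); last by exists negb; exact: negbK.
by apply: eq_avg => b; rewrite sgb_neg.
Qed.

Section Row.
Context {R : realType} (k : nat).
Implicit Type q : {ffun 'I_k -> bool}.

Let phi q : R := walk (sgb R) q.

Lemma sgb_sqr b : sgb R b ^+ 2 = 1.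
Proof. by rewrite /sgb sqrr_sign. Qed.

Lemma avg_row_sqr : avg (fun q => phi q ^+ 2) = k%:R.
Proof.
rewrite avg_walk_sqr ?card_bool//; last exact: sgb_sym.
by rewrite (eq_avg (g := fun=> 1)) ?avg_cst ?card_bool ?mulr1// => b; exact: sgb_sqr.
Qed.

Lemma avg_row_pow4 : avg (fun q => phi q ^+ 4) <= 3 * k%:R ^+ 2.
Proof.
have s2 : avg (fun b => sgb R b ^+ 2) = 1.
  by rewrite (eq_avg (g := fun=> 1)) ?avg_cst ?card_bool// => b; exact: sgb_sqr.
have := @avg_walk_pow4 R _ (sgb R) _ (@sgb_sym R) k.
cbv zeta; rewrite s2 expr1n !mulr1 card_bool; apply=> //.
rewrite (eq_avg (g := fun=> 1)) ?avg_cst ?card_bool// => [|b]; first lra.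
by rewrite (exprM _ 2 2) sgb_sqr expr1n.
Qed.

Definition row_prod (p : {ffun 'I_k -> bool} * {ffun 'I_k -> bool}) : R :=
  phi p.1 * phi p.2.

Lemma row_prod_sym (F : R -> R) :
  avg (fun p => F (- row_prod p)) = avg (fun p => F (row_prod p)).
Proof.
rewrite (avg_pair (fun q q' => F (- (phi q * phi q')))).
rewrite (avg_pair (fun q q' => F (phi q * phi q'))).
apply: eq_avg => q; rewrite -(avg_walk_sym (@sgb_sym R) k (fun w => F (phi q * w))).
by apply: eq_avg => q'; rewrite mulrN.
Qed.

Lemma avg_row_prod_sqr : avg (fun p => row_prod p ^+ 2) = k%:R ^+ 2.
Proof.
rewrite -[in RHS]avg_row_sqr expr2 -avg_mul.
by apply: eq_avg => p; rewrite exprMn.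
Qed.

(** Second moment [k^2] and fourth moment at most [9 k^4] force a first absolute moment of order
    [k]. The Tanaka bound thus applies with [m = k/6]. *)
Lemma avg_row_prod_norm : (0 < k)%N ->
  k%:R / 3 <= avg (fun p => `|row_prod p|).
Proof.
move=> k0; have {}k0 : 0 < k%:R :> R by rewrite ltr0n.
(* [q >= q^2/2 - q^4/54] for [q >= 0], since [q^3 - 27q + 54 = (q-3)^2(q+6)] *)
apply: (@le_trans _ _ (avg (fun p =>
   k%:R^-1 / 2 * row_prod p ^+ 2 + - (k%:R^-3 / 54) * row_prod p ^+ 4))).
  rewrite avgD !avgZ avg_row_prod_sqr.
  have M4 : avg (fun p => row_prod p ^+ 4) <= 9 * k%:R ^+ 4.
    rewrite (eq_avg (g := fun p => phi p.1 ^+ 4 * phi p.2 ^+ 4)); last first.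
      by move=> p; rewrite exprMn.
    rewrite (avg_mul (fun q => phi q ^+ 4) (fun q => phi q ^+ 4)).
    have -> : 9 * k%:R ^+ 4 = (3 * k%:R ^+ 2) * (3 * k%:R ^+ 2) :> R by ring.
    have phi4 : 0 <= avg (fun q => phi q ^+ 4).
      by apply: avg_ge0 => q; rewrite (exprM _ 2 2) sqr_ge0.
    exact: (ler_pM phi4 phi4 avg_row_pow4 avg_row_pow4).
  have : k%:R^-3 / 54 * avg (fun p => row_prod p ^+ 4) <=
      k%:R^-3 / 54 * (9 * k%:R ^+ 4).
    by rewrite ler_wpM2l// divr_ge0// invr_ge0 exprn_ge0// ltW.
  have -> : k%:R^-3 / 54 * (9 * k%:R ^+ 4) = k%:R / 6 :> R.
    by field; rewrite gt_eqF.
  have -> : k%:R^-1 / 2 * k%:R ^+ 2 = k%:R / 2 :> R by field; rewrite gt_eqF.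
  lra.
apply: le_avg => p; set w := row_prod p.
have -> : w ^+ 2 = `|w| ^+ 2 by rewrite real_normK ?num_real.
have -> : w ^+ 4 = `|w| ^+ 4 by rewrite !(exprM _ 2 2) real_normK ?num_real.
set q := `|w|; have q0 : 0 <= q by exact: normr_ge0.
rewrite -subr_ge0.
have -> : q - (k%:R^-1 / 2 * q ^+ 2 + - (k%:R^-3 / 54) * q ^+ 4) =
   q * (q - 3 * k%:R) ^+ 2 * (q + 6 * k%:R) / (54 * k%:R ^+ 3).
  by field; rewrite gt_eqF.
have {}k0 := ltW k0; have k3 : 0 <= k%:R ^+ 3 :> R by rewrite exprn_ge0.
apply: divr_ge0; last lra.
by apply: mulr_ge0; [rewrite mulr_ge0 ?sqr_ge0|lra].
Qed.

End Row.

Definition dotp (R : realType) d k (y y' : {ffun 'I_d * 'I_k -> bool}) : R :=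
  \sum_i (\sum_j sgb R (y (i, j))) * (\sum_j sgb R (y' (i, j))).

(** Regrouping the bits of both points by rows turns [dotp] into a walk with [d] independent
    steps. *)
Lemma avg_dotp (R : realType) d k (F : R -> R) :
  avg (fun p => F (@dotp R d k p.1 p.2)) =
  avg (fun z : {ffun 'I_d -> _} => F (walk (@row_prod R k) z)).
Proof.
pose h (z : {ffun 'I_d -> {ffun 'I_k -> bool} * {ffun 'I_k -> bool}}) :
  {ffun 'I_d * 'I_k -> bool} * {ffun 'I_d * 'I_k -> bool} :=
  ([ffun p => (z p.1).1 p.2], [ffun p => (z p.1).2 p.2]).
have h_bij : bijective h.
  exists (fun p : {ffun 'I_d * 'I_k -> bool} * {ffun 'I_d * 'I_k -> bool} =>
    [ffun i : 'I_d => ([ffun j : 'I_k => p.1 (i, j)], [ffun j : 'I_k => p.2 (i, j)])])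
    => [z|[y y']].
    apply/ffunP => i; rewrite ffunE [RHS]surjective_pairing.
    by congr pair; apply/ffunP => j; rewrite !ffunE.
  by congr pair; apply/ffunP => -[i j]; rewrite !ffunE.
rewrite (reindex_avg _ h_bij); apply: eq_avg => z; congr F.
rewrite /dotp /walk; apply: eq_bigr => i _.
by congr (_ * _); apply: eq_bigr => j _; rewrite ffunE.
Qed.

(** The window probabilities for [d < e^2] add up to order [e], so one of them is of order [1/e].
    Steps and window both scale with [k], which is why [D] can be fixed before [k]. *)
Lemma dotp_small (R : realType) (g : R) (eta : R) : 0 < eta ->
  exists D, forall k, (0 < k)%N -> exists2 d, (d < D)%N &
    avg (fun p => (`|@dotp R d k p.1 p.2| <= g * k%:R)%R%:R) <= eta.
Proof.
move=> eta0.
pose p := Num.truncn (6 * g).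
have gp : g <= 2 ^+ p / 6.
  rewrite ler_pdivlMr// mulrC (le_trans (ltW (truncnS_gt _)))// -natrX ler_nat.
  exact: ltn_expl.
(* The average probability over [d < e^2] is at most [2^p (k e) / (k/6) / e^2 = 6 2^p / e], which is
   below [eta] for this [e]. *)
pose e := (Num.truncn (6 * 2 ^+ p / eta)).+1.
have e0 : 6 * 2 ^+ p < e%:R * eta by rewrite -ltr_pdivrMr// truncnS_gt.
exists (e ^ 2)%N => k k0.
have kR0 : 0 < k%:R :> R by rewrite ltr0n.
have eR0 : 0 < e%:R :> R by rewrite ltr0n.
have Q0 : (0 < #|{ffun 'I_k -> bool}|)%N by rewrite card_ffun expn_gt0 card_bool.
have S0 : (0 < #|{: {ffun 'I_k -> bool} * {ffun 'I_k -> bool}}|)%N.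
  by rewrite card_prod muln_gt0 Q0.
(* This is [E|Z| <= sqrt (E Z^2) = k e], obtained from [q <= q^2 / (2 k e) + k e / 2]. *)
have Z2 : avg (fun z => `|@walk _ _ (@row_prod R k) (e ^ 2) z|) <= k%:R * e%:R.
  apply: (@le_trans _ _ (avg (fun z =>
     (2 * (k%:R * e%:R))^-1 * (@walk _ _ (@row_prod R k) (e ^ 2) z) ^+ 2 +
       k%:R * e%:R / 2))).
    apply: le_avg => z; set w := walk _ _; rewrite -[w ^+ 2]real_normK ?num_real//.
    set q := `|w|; rewrite -subr_ge0.
    have -> : (2 * (k%:R * e%:R))^-1 * q ^+ 2 + k%:R * e%:R / 2 - q =
      (q - k%:R * e%:R) ^+ 2 / (2 * (k%:R * e%:R)).
      by field; rewrite !gt_eqF.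
    by rewrite divr_ge0 ?sqr_ge0// !mulr_ge0// ltW.
  rewrite avgD avgZ avg_walk_sqr//; last exact: row_prod_sym.
  rewrite avg_row_prod_sqr avg_cst ?card_ffun ?expn_gt0 ?S0// natrX.
  by rewrite le_eqVlt; apply/orP; left; apply/eqP; field; rewrite !gt_eqF.
have step : 2 * (k%:R / 6) <= avg (fun p => `|@row_prod R k p|).
  by apply: le_trans (avg_row_prod_norm k0); lra.
have k6 : 0 <= k%:R / 6 :> R by rewrite divr_ge0// ltW.
have := sum_avg_walk_window S0 (@row_prod_sym R k) (e ^ 2) p 0 k6 step.
apply: contraPP => /forall2NP big; apply/negP; rewrite -ltNge.
apply: le_lt_trans (_ : 2 ^+ p * (k%:R * e%:R) < _).
  by rewrite ler_pM2l// exprn_gt0.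
apply: (@lt_le_trans _ _ (k%:R / 6 * \sum_(d < (e ^ 2)%N) eta)).
  rewrite sumr_const card_ord -[eta *+ _]mulr_natr natrX.
  have -> : k%:R / 6 * (eta * e%:R ^+ 2) = (e%:R * eta) / 6 * (k%:R * e%:R) by ring.
  by rewrite ltr_pM2r ?mulr_gt0//; lra.
rewrite ler_wpM2l// ler_sum// => d _.
have [/negP|/negP] := big d; first by rewrite ltn_ord.
rewrite -ltNge (avg_dotp d k (fun w => (`|w| <= g * k%:R)%R%:R)) => /ltW /le_trans.
apply; apply: le_avg => z; rewrite subr0.
case: (leP `|_| (g * _)) => [zg|_]; last by rewrite ler0n.
rewrite (le_trans zg)//; have := ler_pM2r kR0 g (2 ^+ p / 6).
by rewrite gp mulrA mulrAC.
Qed.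

(** By symmetry the mass outside the window is shared equally by the two tails. *)
Lemma dotp_large (R : realType) (g : R) (eta : R) : 0 <= g -> 0 < eta ->
  exists D, forall k, (0 < k)%N -> exists2 d, (d < D)%N &
    (1 - eta) / 2 <= avg (fun p => (g * k%:R < @dotp R d k p.1 p.2)%R%:R).
Proof.
move=> g0 eta0; have [D HD] := @dotp_small R g eta eta0; exists D => k k0.
have [d dD small] := HD k k0; exists d => //.
have sym : avg (fun p => (g * k%:R < - @dotp R d k p.1 p.2)%R%:R) =
    avg (fun p => (g * k%:R < @dotp R d k p.1 p.2)%R%:R) :> R.
  rewrite (avg_dotp d k (fun w => (g * k%:R < - w)%R%:R)).
  rewrite (avg_walk_sym (@row_prod_sym R k) d (fun w => (g * k%:R < w)%R%:R)).
  by rewrite -(avg_dotp d k (fun w => (g * k%:R < w)%R%:R)).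
have : 1 <= avg (fun p => (`|@dotp R d k p.1 p.2| <= g * k%:R)%R%:R +
    ((g * k%:R < @dotp R d k p.1 p.2)%R%:R +
     (g * k%:R < - @dotp R d k p.1 p.2)%R%:R)) :> R.
  have one : avg (fun _ : {ffun 'I_d * 'I_k -> bool} *
      {ffun 'I_d * 'I_k -> bool} => 1 : R) = 1.
    by rewrite avg_cst// card_prod card_ffun card_bool -expnD expn_gt0.
  rewrite -[leLHS]one; apply: le_avg => p; set w := dotp _ _ _.
  have [wg|] := leP `|w| (g * k%:R); first by rewrite lerDl addr_ge0.
  by rewrite lter_normr add0r => /orP[->|->]; rewrite ?lerDl ?lerDr ?ler0n.
by rewrite !avgD sym; lra.
Qed.

(** * Concentration on the discrete cube *)

Section Poincare.
Context {R : realType} {I : finType}.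
Local Notation cube := {ffun I -> bool}.
Implicit Types (f : cube -> R) (b c : I) (x : cube).

Definition flip b x : cube := [ffun i => x i (+) (i == b)].

Lemma flipK b : involutive (flip b).
Proof. by move=> x; apply/ffunP => i; rewrite !ffunE addbK. Qed.

Lemma flipC b c x : flip b (flip c x) = flip c (flip b x).
Proof. by apply/ffunP => i; rewrite !ffunE addbAC. Qed.

Lemma sum_flip b f : \sum_x f (flip b x) = \sum_x f x.
Proof. by rewrite [RHS](reindex_inj (inv_inj (flipK b))). Qed.

(** Conditional expectation given all bits but [b]; once every bit is smoothed, only the mean is
    left. *)
Definition smooth b f x : R := (f x + f (flip b x)) / 2.

Fixpoint smooths (s : seq I) f : cube -> R :=
  if s is b :: s' then smooths s' (smooth b f) else f.

Lemma sum_smooth b f : \sum_x smooth b f x = \sum_x f x.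
Proof. by rewrite -mulr_suml big_split /= sum_flip; lra. Qed.

Lemma sum_smooths s f : \sum_x smooths s f x = \sum_x f x.
Proof. by elim: s f => //= b s IH f; rewrite IH sum_smooth. Qed.

Lemma sum_smooth_sqr b f :
  \sum_x f x ^+ 2 - \sum_x smooth b f x ^+ 2 =
  4^-1 * \sum_x (f x - f (flip b x)) ^+ 2.
Proof.
have -> : \sum_x f x ^+ 2 = \sum_x (f x ^+ 2 + f (flip b x) ^+ 2) / 2.
  by rewrite -mulr_suml big_split /= (sum_flip b (fun x => f x ^+ 2)); lra.
by rewrite -sumrB mulr_sumr; apply: eq_bigr => x _; rewrite /smooth; field.
Qed.

(** Convexity of the square: averaging over bit [b] cannot increase the energy in direction [c]. *)
Lemma smooth_contracts b c f :
  \sum_x (smooth b f x - smooth b f (flip c x)) ^+ 2 <=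
  \sum_x (f x - f (flip c x)) ^+ 2.
Proof.
have -> : \sum_x (f x - f (flip c x)) ^+ 2 = \sum_x
    ((f x - f (flip c x)) ^+ 2 + (f (flip b x) - f (flip c (flip b x))) ^+ 2) / 2.
  rewrite -mulr_suml big_split /=.
  by rewrite (sum_flip b (fun x => (f x - f (flip c x)) ^+ 2)); lra.
apply: ler_sum => x _; rewrite /smooth (flipC b c) -subr_ge0.
set p := f x; set q := f _; set u := f _; set v := f _.
have -> : ((p - q) ^+ 2 + (u - v) ^+ 2) / 2 - ((p + u) / 2 - (q + v) / 2) ^+ 2 =
  ((p - q - u + v) / 2) ^+ 2 by field.
exact: sqr_ge0.
Qed.

Lemma sum_smooths_sqr s f :
  \sum_x f x ^+ 2 - \sum_x smooths s f x ^+ 2 <=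
  4^-1 * \sum_(b <- s) \sum_x (f x - f (flip b x)) ^+ 2.
Proof.
elim: s f => [|b s IH] f /=; first by rewrite subrr big_nil mulr0.
rewrite big_cons mulrDr -sum_smooth_sqr.
have : \sum_(c <- s) \sum_x (smooth b f x - smooth b f (flip c x)) ^+ 2 <=
    \sum_(c <- s) \sum_x (f x - f (flip c x)) ^+ 2.
  by apply: ler_sum => c _; exact: smooth_contracts.
have := IH (smooth b f); lra.
Qed.

Lemma smooths_invariant s b f :
  (forall x, f (flip b x) = f x) -> forall x, smooths s f (flip b x) = smooths s f x.
Proof.
elim: s f => //= c s IH f fb; apply: IH => x.
by rewrite /smooth fb (flipC c b) fb.
Qed.

Lemma smooths_flip s b f x : b \in s -> smooths s f (flip b x) = smooths s f x.
Proof.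
elim: s f => //= c s IH f; rewrite inE => /orP[/eqP->|bs]; last exact: IH.
by apply: smooths_invariant => y; rewrite /smooth flipK addrC.
Qed.

Lemma smooths_cst f x y : smooths (enum I) f x = smooths (enum I) f y.
Proof.
(* [x] is turned into [y] one bit at a time; in [patch s] the bits of [s] have been changed. *)
pose patch (s : seq I) : cube := [ffun i => if i \in s then y i else x i].
suff patchE s : smooths (enum I) f x = smooths (enum I) f (patch s).
  by rewrite (patchE (enum I)); congr smooths; apply/ffunP => i; rewrite ffunE mem_enum.
elim: s => [|b s ->]; first by congr smooths; apply/ffunP => i; rewrite ffunE.
have [eq_b|neq_b] := eqVneq (patch s b) (y b).
  congr smooths; apply/ffunP => i; rewrite [in RHS]ffunE inE.
  by case: eqP => [->//|_]; rewrite ffunE.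
rewrite -(@smooths_flip _ b) ?mem_enum//; congr smooths.
apply/ffunP => i; rewrite ffunE [in RHS]ffunE inE; case: eqP => [->|_] /=.
  by move: neq_b; rewrite addbT; case: (patch s b); case: (y b).
by rewrite addbF ffunE.
Qed.

(** Smoothing the bits in turn takes [f] to its mean, and each smoothing loses at most a quarter of
    the energy of [f] in its direction. *)
Lemma poincare f :
  \sum_x f x ^+ 2 - (\sum_x f x) ^+ 2 / #|{: cube}|%:R <=
  4^-1 * \sum_b \sum_x (f x - f (flip b x)) ^+ 2.
Proof.
have N0 : #|{: cube}|%:R != 0 :> R.
  by rewrite pnatr_eq0 card_ffun card_bool expn_eq0.
have -> : (\sum_x f x) ^+ 2 / #|{: cube}|%:R = \sum_x smooths (enum I) f x ^+ 2.
  pose x0 : cube := [ffun=> true].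
  rewrite -(sum_smooths (enum I)).
  rewrite (eq_bigr (fun=> smooths (enum I) f x0)) => [|x _]; last exact: smooths_cst.
  rewrite [RHS](eq_bigr (fun=> smooths (enum I) f x0 ^+ 2)) => [|x _].
    by rewrite !sumr_const -[in LHS]mulr_natr -[in RHS]mulr_natr; field.
  by rewrite (smooths_cst f x x0).
by have := sum_smooths_sqr (enum I) f; rewrite big_enum.
Qed.

(** A gap [t] between the values on [A] and on [B] forces a large variance, which the Poincare
    inequality limits. *)
Lemma poincare_sets f (A B : {set cube}) (t v : R) : 0 <= t ->
  (forall x y, x \in A -> y \in B -> f x + t <= f y) ->
  (forall x, \sum_b Num.max 0 (f (flip b x) - f x) ^+ 2 <= v) ->
  #|A|%:R * #|B|%:R * t ^+ 2 <= v * #|{: cube}|%:R ^+ 2.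
Proof.
move=> t0 fAB fv; set N := #|{: cube}|%:R : R.
have N0 : 0 < N by rewrite ltr0n card_ffun card_bool expn_gt0.
have grad : \sum_b \sum_x (f x - f (flip b x)) ^+ 2 <= 2 * v * N.
  have -> : \sum_b \sum_x (f x - f (flip b x)) ^+ 2 =
      2 * \sum_x \sum_b Num.max 0 (f (flip b x) - f x) ^+ 2.
    rewrite [in RHS]exchange_big mulr_sumr; apply: eq_bigr => b _.
    have -> : \sum_x (f x - f (flip b x)) ^+ 2 = \sum_x
        (Num.max 0 (f (flip b x) - f x) ^+ 2 + Num.max 0 (f x - f (flip b x)) ^+ 2).
      apply: eq_bigr => x _; rewrite -opprB sqrrN; set a := f (flip b x) - f x.
      have [a0|/ltW a0] := leP 0 a.
        by rewrite [in X in _ = _ + X]max_l ?oppr_le0// expr0n addr0.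
      by rewrite max_r ?oppr_ge0// expr0n add0r sqrrN.
    rewrite big_split /=.
    rewrite -(sum_flip b (fun x => Num.max 0 (f x - f (flip b x)) ^+ 2)) /=.
    under [X in _ + X]eq_bigr do rewrite flipK.
    by lra.
  rewrite -mulrA ler_pM2l//; apply: (@le_trans _ _ (\sum_(x : cube) v)).
    exact: ler_sum.
  by rewrite sumr_const -[v *+ _]mulr_natr.
have cross : #|A|%:R * #|B|%:R * t ^+ 2 <= \sum_x \sum_y (f x - f y) ^+ 2.
  apply: (@le_trans _ _ (\sum_(x in A) \sum_(y in B) t ^+ 2)).
    by rewrite !sumr_const -mulrnA -[leRHS]mulr_natl natrM mulrC [_%:R * _]mulrC mulrC.
  apply: (@le_trans _ _ (\sum_(x in A) \sum_(y in B) (f x - f y) ^+ 2)).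
    apply: ler_sum => x xA; apply: ler_sum => y yB; have := fAB x y xA yB.
    by move=> ?; rewrite -[leRHS]sqrrN opprB ler_sqr ?nnegrE//; lra.
  rewrite [leRHS](bigID (mem A)) /= -[leLHS]addr0 lerD//.
    apply: ler_sum => x _; rewrite [leRHS](bigID (mem B)) /= lerDl.
    by apply: sumr_ge0 => y _; exact: sqr_ge0.
  by apply: sumr_ge0 => x _; apply: sumr_ge0 => y _; exact: sqr_ge0.
apply: le_trans cross _.
(* Over ordered pairs the squared differences add up to [2 N] times the centred sum of squares. *)
have -> : \sum_x \sum_y (f x - f y) ^+ 2 =
    2 * N * (\sum_x f x ^+ 2 - (\sum_x f x) ^+ 2 / N).
  pose M := \sum_y f y ^+ 2; pose m := \sum_y f y.
  transitivity (\sum_x (N * f x ^+ 2 + ((- (2 * m)) * f x + M))).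
    apply: eq_bigr => x _.
    transitivity (\sum_y (f x ^+ 2 + ((- (2 * f x)) * f y + f y ^+ 2))).
      by apply: eq_bigr => y _; ring.
    rewrite !big_split /= sumr_const -mulr_sumr -[_ *+ _]mulr_natl -/m -/M; ring.
  rewrite !big_split /= -!mulr_sumr sumr_const -[_ *+ _]mulr_natl -/m -/M -/N.
  by field; rewrite gt_eqF.
have P := poincare f; rewrite -/N in P.
have -> : v * N ^+ 2 = 2 * N * (4^-1 * (2 * v * N)) by field.
rewrite ler_pM2l ?mulr_gt0//; apply: le_trans P _.
by rewrite ler_pM2l.
Qed.

End Poincare.

(** * Concentration for the distance between block-sum vectors *)

Section Concentration.
Context {R : realType} {C : finType} (k : nat).
Hypotheses (k0 : (0 < k)%N) (Ck : (#|C| <= k)%N).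
Local Notation cube := {ffun C * 'I_k -> bool}.

Definition blocksum (x : cube) (c : C) : R := \sum_j sgb R (x (c, j)).

Definition dist2 (x y : cube) : R := \sum_c (blocksum x c - blocksum y c) ^+ 2.

Lemma blocksum_flip (x : cube) b c :
  blocksum (flip b x) c = blocksum x c - (if c == b.1 then 2 * sgb R (x b) else 0).
Proof.
case: b => c' j; rewrite /blocksum /=; case: eqP => [->|cc']; last first.
  rewrite subr0; apply: eq_bigr => i _; rewrite ffunE xpair_eqE.
  by case: eqP => // _; rewrite addbF.
rewrite (bigD1 j)//= [in RHS](bigD1 j)//= ffunE eqxx addbT sgb_neg.
have cancel (s a b : R) : a = b -> - s + a = s + b - 2 * s by move=> ->; ring.
by apply: cancel; apply: eq_bigr => i ij; rewrite ffunE xpair_eqE eqxx (negPf ij) addbF.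
Qed.

Lemma dist2_flip (x y : cube) b :
  dist2 (flip b x) y <= dist2 x y + (4 * `|blocksum x b.1 - blocksum y b.1| + 4).
Proof.
rewrite /dist2 (bigD1 b.1)//= [in leRHS](bigD1 b.1)//=.
rewrite (eq_bigr (fun c => (blocksum x c - blocksum y c) ^+ 2)); last first.
  by move=> c /negPf cb; rewrite blocksum_flip cb subr0.
rewrite addrAC lerD2r blocksum_flip eqxx; set v := blocksum x b.1 - blocksum y b.1.
have -> : blocksum x b.1 - 2 * sgb R (x b) - blocksum y b.1 = v - 2 * sgb R (x b).
  by rewrite /v; ring.
have s2 := sgb_sqr (R := R) (x b).
have : - (sgb R (x b) * v) <= `|v|.
  by rewrite ler_normr /sgb; case: (x b); rewrite ?expr0 ?expr1; lra.
move: s2; set s := sgb R _ => s2 sv.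
have -> : (v - 2 * s) ^+ 2 = v ^+ 2 - 4 * (s * v) + 4 * s ^+ 2 by ring.
by rewrite s2; lra.
Qed.

(* The discrete gradient of [sqrt (1 + dist(x, A)^2 / k)] is bounded only in the
   increasing direction, because [dist(x, A)^2] is a minimum of quadratics.  This
   suffices, since each edge of the cube is increasing from one of its ends. *)
Lemma concentration (A : {set cube}) (t : R) : 0 <= t ->
  #|A|%:R * #|[set x | [forall a in A, (1 + t) ^+ 2 * k%:R <= dist2 x a]]|%:R * t ^+ 2
  <= 8 * #|{: cube}|%:R ^+ 2.
Proof.
move=> t0; have [->|[a0 a0A]] := set_0Vmem A.
  by rewrite cards0 !mul0r mulr_ge0// sqr_ge0.
have kR0 : 0 < k%:R :> R by rewrite ltr0n.
pose near x := [arg min_(a < a0 | a \in A) dist2 x a]%O.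
have nearA x : near x \in A by rewrite /near; case: Order.TotalTheory.arg_minP.
have near_min x a : a \in A -> dist2 x (near x) <= dist2 x a.
  by rewrite /near; case: Order.TotalTheory.arg_minP => // b _; exact.
have d0 x y : 0 <= dist2 x y by apply: sumr_ge0 => c _; exact: sqr_ge0.
pose g x := Num.sqrt (1 + dist2 x (near x) / k%:R).
have g2 x : g x ^+ 2 = 1 + dist2 x (near x) / k%:R.
  by rewrite sqr_sqrtr// addr_ge0// divr_ge0// ler0n.
have g0 x : 0 <= g x by exact: sqrtr_ge0.
apply: (poincare_sets (f := g) t0) => [x y xA|x].
  rewrite inE => /forall_inP /(_ _ (nearA y)) yA.
  have -> : g x = 1.
    have : dist2 x (near x) <= 0.
      apply: le_trans (near_min x x xA) _.
      by rewrite /dist2 big1// => c _; rewrite subrr expr0n.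
    move=> dx; have {dx}dx : dist2 x (near x) = 0 by apply/eqP; rewrite eq_le dx d0.
    by rewrite /g dx mul0r addr0 sqrtr1.
  rewrite -(ger0_norm (_ : 0 <= 1 + t)) ?addr_ge0// -sqrtr_sqr ler_wsqrtr//.
  by rewrite -ler_pdivlMr// in yA; rewrite (le_trans yA)// lerDr.
pose v c := blocksum x c - blocksum (near x) c.
have gx0 : 0 < g x by rewrite sqrtr_gt0 ltr_pwDl// divr_ge0// ler0n.
(* A flip raises the squared distance by at most [4 m + 4], and [(g + h)^2 - g^2 >= 2 g h] turns
   this into a bound on the increment [h]. *)
have bound b : Num.max 0 (g (flip b x) - g x) ^+ 2 <=
    (8 * v b.1 ^+ 2 + 8) / (k%:R ^+ 2 * g x ^+ 2).
  have rhs0 : 0 <= (8 * v b.1 ^+ 2 + 8) / (k%:R ^+ 2 * g x ^+ 2).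
    have := sqr_ge0 (v b.1) => v0; apply: divr_ge0; first lra.
    by rewrite mulr_ge0 ?sqr_ge0.
  have [_|gg] := leP (g (flip b x) - g x) 0; first by rewrite expr0n.
  rewrite ler_pdivlMr ?mulr_gt0 ?exprn_gt0//.
  set h := g _ - g x in gg *; pose m := `|v b.1|.
  have m0 : 0 <= m by exact: normr_ge0.
  have -> : v b.1 ^+ 2 = m ^+ 2 by rewrite real_normK ?num_real.
  have : g (flip b x) ^+ 2 <= g x ^+ 2 + (4 * m + 4) / k%:R.
    rewrite !g2 -addrA -mulrDl lerD2l ler_pM2r ?invr_gt0//.
    apply: le_trans (near_min _ _ (nearA x)) _; exact: dist2_flip.
  have -> : g (flip b x) = g x + h by rewrite /h; ring.
  rewrite -lerBlDl ler_pdivlMr// => hm.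
  have {}hm : k%:R * g x * h <= 2 * m + 2.
    have : 0 <= h ^+ 2 * k%:R by rewrite mulr_ge0 ?sqr_ge0// ltW.
    by nra.
  apply: (@le_trans _ _ ((2 * m + 2) ^+ 2)); last first.
    rewrite -subr_ge0.
    have -> : 8 * m ^+ 2 + 8 - (2 * m + 2) ^+ 2 = 4 * (m - 1) ^+ 2 by ring.
    by rewrite mulr_ge0 ?sqr_ge0.
  have -> : h ^+ 2 * (k%:R ^+ 2 * g x ^+ 2) = (k%:R * g x * h) ^+ 2 by ring.
  by rewrite ler_sqr ?nnegrE// ?mulr_ge0// ?ltW//; lra.
apply: (@le_trans _ _ (\sum_(b : C * 'I_k) (8 * v b.1 ^+ 2 + 8) / (k%:R ^+ 2 * g x ^+ 2))).
  exact: ler_sum.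
rewrite -mulr_suml ler_pdivrMr ?mulr_gt0 ?exprn_gt0//.
(* The sum over all bits is [8 k (dist2 + #|C|)], at most [8 k^2 g^2] because there are at most [k]
   blocks. *)
have -> : \sum_(b : C * 'I_k) (8 * v b.1 ^+ 2 + 8) =
    \sum_c \sum_(j < k) (8 * v c ^+ 2 + 8) by rewrite pair_bigA.
have -> : \sum_c \sum_(j < k) (8 * v c ^+ 2 + 8) =
    8 * k%:R * (dist2 x (near x) + #|C|%:R).
  rewrite (eq_bigr (fun c => k%:R * (8 * v c ^+ 2 + 8))) => [|c _]; last first.
    by rewrite sumr_const card_ord -[LHS]mulr_natl.
  rewrite -mulr_sumr big_split /= -mulr_sumr sumr_const -[_ *+ _]mulr_natl /dist2; ring.
rewrite g2; have -> : 8 * (k%:R ^+ 2 * (1 + dist2 x (near x) / k%:R)) =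
   8 * k%:R * (dist2 x (near x) + k%:R) by field; rewrite gt_eqF.
by rewrite ler_pM2l ?mulr_gt0// lerD2l ler_nat.
Qed.

End Concentration.

(** * Sparse hypergraphs with small independence number *)

Lemma card_bigcup_le_sum (I V : finType) (P : pred I) (F : I -> {set V}) :
  (#|\bigcup_(i | P i) F i| <= \sum_(i | P i) #|F i|)%N.
Proof.
elim/big_rec2: _ => [|i m A Pi Am]; first by rewrite cards0.
by rewrite (leq_trans (leq_card_setU _ _))// leq_add2l.
Qed.

Section Sparse.
Context {T : finType}.
Implicit Types (E : {set {set T}}) (e f : {set T}) (x y a b c : T).

(* For edges of size at least 3 this includes linearity: if [e] and [f] share
   [b] and [c], take [g = e].  Hence a set of vertices that are pairwise covered
   by edges lies in a single edge. *)
Definition triangle_free E := forall e f g a b c,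
  e \in E -> f \in E -> g \in E -> a != b -> b != c -> a != c ->
  a \in e -> b \in e -> b \in f -> c \in f -> a \in g -> c \in g -> e = f.

Definition nbr E x : {set T} := \bigcup_(f in E | x \in f) f.

Definition nbr2 E x : {set T} := \bigcup_(y in nbr E x) nbr E y.

Definition degree E x : nat := #|[set f in E | x \in f]|.

Lemma mem_nbr E f x y : f \in E -> x \in f -> y \in f -> y \in nbr E x.
Proof. by move=> fE xf yf; apply/bigcupP; exists f; rewrite // fE. Qed.

Lemma mem_nbr2 E x y z : y \in nbr E x -> z \in nbr E y -> z \in nbr2 E x.
Proof. by move=> yx zy; apply/bigcupP; exists y. Qed.

Lemma nbr_sub_nbr2 E x y : y \in nbr E x -> y \in nbr2 E x.
Proof.
move=> yx; have /bigcupP[f /andP[fE _] yf] := yx.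
exact: (mem_nbr2 yx (mem_nbr fE yf yf)).
Qed.

Section Extend.
Variables (E : {set {set T}}) (e : {set T}).
Hypothesis far : forall x y, x \in e -> y \in e -> x != y -> y \notin nbr2 E x.

Let far1 f x y : f \in E -> x \in e -> y \in e -> x != y -> x \in f -> y \in f ->
  False.
Proof.
move=> fE xe ye xy xf yf; have /negP := far xe ye xy; apply.
exact/nbr_sub_nbr2/(mem_nbr fE).
Qed.

Let far2 f g x y z : f \in E -> g \in E -> x \in e -> z \in e -> x != z ->
  x \in f -> y \in f -> y \in g -> z \in g -> False.
Proof.
move=> fE gE xe ze xz xf yf yg zg; have /negP := far xe ze xz; apply.
exact: (mem_nbr2 (mem_nbr fE xf yf) (mem_nbr gE yg zg)).
Qed.

(** A violation involving the new edge would link two of its vertices by one or two old edges,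
    against [far]. *)
Lemma triangle_freeU1 : triangle_free E -> triangle_free (e |: E).
Proof.
move=> tri f g h a b c /setU1P[->|fE] /setU1P[->|gE] //.
- move=> /setU1P[->|hE] ab bc ac ae be bg cg ah ch.
    by case: (far1 gE be ch).
  by rewrite eq_sym in bc; case: (far2 hE gE ae be ab ah ch cg bg).
- move=> /setU1P[->|hE] ab bc ac af bf be ce ah ch.
    by case: (far1 fE ah be).
  by case: (far2 fE hE be ce bc bf af ah ch).
- move=> /setU1P[->|hE] ab bc ac af bf bg cg ah ch.
    by case: (far2 fE gE ah ch ac af bf bg cg).
  exact: tri ab bc ac af bf bg cg ah ch.
Qed.

End Extend.

Lemma card_bigcup_le (I : finType) (P : pred I) (F : I -> {set T}) (n : nat) :
  (forall i, P i -> (#|F i| <= n)%N) -> (#|\bigcup_(i | P i) F i| <= #|P| * n)%N.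
Proof.
move=> Fn; rewrite -sum_nat_const.
by apply: leq_trans (card_bigcup_le_sum _ _) _; exact: leq_sum.
Qed.

Lemma card_nbr E r D x : (forall f, f \in E -> #|f| = r) ->
  (degree E x <= D)%N -> (#|nbr E x| <= D * r)%N.
Proof.
move=> unif deg; apply: leq_trans (card_bigcup_le (n := r) _) _.
  by move=> f /andP[/unif->].
by rewrite leq_mul2r; apply/orP; right; apply: leq_trans deg; rewrite /degree cardsE.
Qed.

Lemma card_nbr2 E r D x : (forall f, f \in E -> #|f| = r) ->
  (forall y, degree E y <= D)%N -> (#|nbr2 E x| <= (D * r) ^ 2)%N.
Proof.
move=> unif deg; apply: leq_trans (card_bigcup_le (n := D * r) _) _.
  by move=> y _; exact: card_nbr.
by rewrite leq_mul2r; apply/orP; right; exact: card_nbr.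
Qed.

Lemma sum_degree E r : (forall f, f \in E -> #|f| = r) ->
  (\sum_x degree E x = #|E| * r)%N.
Proof.
move=> unif; rewrite -sum_nat_const.
transitivity (\sum_x \sum_(f in E) (x \in f : nat))%N.
  apply: eq_bigr => x _; rewrite /degree -sum1_card big_mkcond [RHS]big_mkcond.
  by apply: eq_bigr => f _; rewrite inE; case: (f \in E); case: (x \in f).
rewrite exchange_big; apply: eq_bigr => f fE.
by rewrite -(unif f fE) -sum1_card [RHS]big_mkcond; apply: eq_bigr => x _; case: (x \in f).
Qed.

(* The involution [(t, y) |-> (t[j := y], t j)] shows that [t j] is independent
   of [t i]. *)
Lemma card_related_coords (r m : nat) (i j : 'I_r) (bad : T -> {set T}) : i != j ->
  (forall x, #|bad x| <= m)%N ->
  (#|[set t : {ffun 'I_r -> T} | t j \in bad (t i)]| * #|T| <= m * #|T| ^ r)%N.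
Proof.
move=> ij badm.
pose swap (p : {ffun 'I_r -> T} * T) : {ffun 'I_r -> T} * T :=
  ([ffun l => if l == j then p.2 else p.1 l], p.1 j).
have swapK : involutive swap.
  move=> [t y]; rewrite /swap /= ffunE eqxx; congr pair.
  by apply/ffunP => l; rewrite !ffunE; case: eqP => [->|].
have -> : (#|[set t : {ffun 'I_r -> T} | t j \in bad (t i)]| * #|T| =
    \sum_(p : {ffun 'I_r -> T} * T) (p.1 j \in bad (p.1 i)))%N.
  rewrite -(pair_bigA _ (fun (t : {ffun 'I_r -> T}) y => (t j \in bad (t i) : nat))) /=.
  rewrite -[#|[set _ | _]|]sum1_card big_distrl [LHS]big_mkcond.
  apply: eq_bigr => t _ /=; rewrite inE sum_nat_const.
  by case: (_ \in _); rewrite ?muln1 ?muln0 ?mul1n.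
rewrite (reindex_inj (inv_inj swapK)) /=.
rewrite (eq_bigr (fun p : {ffun 'I_r -> T} * T => (p.2 \in bad (p.1 i) : nat))); last first.
  by move=> [t y] _ /=; rewrite !ffunE eqxx (negPf ij).
rewrite -(pair_bigA _ (fun (t : {ffun 'I_r -> T}) y => (y \in bad (t i) : nat))) /=.
apply: leq_trans (_ : \sum_(t : {ffun 'I_r -> T}) m <= _)%N; last first.
  by rewrite sum_nat_const card_ffun card_ord mulnC.
apply: leq_sum => t _; apply: leq_trans (badm (t i)).
by rewrite -sum1_card [X in (_ <= X)%N]big_mkcond; apply: leq_sum => y _; case: (_ \in _).
Qed.

Definition transversal r (A : {ffun 'I_r -> {set T}}) (t : {ffun 'I_r -> T}) :=
  [forall i, t i \in A i].

Definition edge_of r (t : {ffun 'I_r -> T}) : {set T} := [set t i | i : 'I_r].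

Definition hits E r (A : {ffun 'I_r -> {set T}}) :=
  [exists t, transversal A t && (edge_of t \in E)].

(** [t i] is added to [nbr2] to make [t] injective: a vertex in no edge is not in its own [nbr2]. *)
Definition addable E r D (t : {ffun 'I_r -> T}) :=
  [forall i, (degree E (t i) < D)%N] &&
  [forall i, forall j, (i != j) ==> (t j \notin t i |: nbr2 E (t i))].

Definition sparse E r D := [/\ forall f, f \in E -> #|f| = r,
  triangle_free E & forall x, (degree E x <= D)%N].

Lemma card_transversals r (A : {ffun 'I_r -> {set T}}) :
  #|[set t | transversal A t]| = (\prod_i #|A i|)%N.
Proof.
have -> : #|[set t | transversal A t]| = #|family (fun i => mem (A i))|.
  by apply: eq_card => t; rewrite inE; apply/forallP/familyP => tA i; exact: tA.
by rewrite card_family foldrE big_image.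
Qed.

Lemma addable_inj E r D (t : {ffun 'I_r -> T}) : addable E D t -> injective t.
Proof.
move=> /andP[_ /forallP far] i j tij; apply/eqP/negPn/negP => ij.
by have /forallP/(_ j) := far i; rewrite ij tij !inE eqxx.
Qed.

Lemma sparse_add E r D (t : {ffun 'I_r -> T}) :
  sparse E r D -> addable E D t -> sparse (edge_of t |: E) r D.
Proof.
move=> [unif tri deg] addt; have tinj := addable_inj addt.
have /andP[/forallP degt /forallP far] := addt.
have fart x y : x \in edge_of t -> y \in edge_of t -> x != y -> y \notin nbr2 E x.
  move=> /imsetP[i _ ->] /imsetP[j _ ->] tij; have /forallP/(_ j) := far i.
  have -> : i != j by apply: contraNneq tij => ->.
  by rewrite !inE negb_or => /andP[].
split.
- by move=> f /setU1P[->|/unif//]; rewrite card_imset// card_ord.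
- exact: triangle_freeU1.
- move=> x; have [/imsetP[i _ ->]|xt] := boolP (x \in edge_of t).
    apply: leq_trans (degt i); rewrite /degree.
    apply: leq_trans (subset_leq_card (_ : _ \subset edge_of t |: [set f in E | t i \in f])) _.
      by apply/fintype.subsetP => f; rewrite !inE => /andP[/orP[->|->] ->]; rewrite // orbT.
    by rewrite cardsU1 -add1n leq_add2r leq_b1.
  apply: leq_trans (deg x); apply: subset_leq_card; apply/fintype.subsetP => f.
  by rewrite !inE => /andP[/orP[/eqP->|->]] //; rewrite (negPf xt).
Qed.

(** Union bound over the pairs [i != j]: bounded degree makes [nbr2] bounded, so few tuples have
    [t j] close to [t i]. *)
Lemma card_addable E r D (A : {ffun 'I_r -> {set T}}) : (0 < r)%N ->
  sparse E r D ->
  (\prod_i #|A i :&: [set x | (degree E x < D)%N]| * #|T| <=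
   #|[set t | addable E D t && transversal A t]| * #|T| +
   r ^ 2 * (((D * r) ^ 2).+1 * #|T| ^ r))%N.
Proof.
move=> r0 [unif tri deg]; set b := ((D * r) ^ 2).+1.
pose A' : {ffun 'I_r -> {set T}} :=
  [ffun i => A i :&: [set x | (degree E x < D)%N]].
pose bad x := x |: nbr2 E x.
have cbad x : (#|bad x| <= b)%N.
  by rewrite cardsU1 /b -add1n leq_add ?leq_b1// card_nbr2.
pose B (p : 'I_r * 'I_r) := [set t : {ffun 'I_r -> T} | t p.2 \in bad (t p.1)].
have -> : (\prod_i #|A i :&: [set x | (degree E x < D)%N]| =
    #|[set t | transversal A' t]|)%N.
  by rewrite card_transversals; apply: eq_bigr => i _; rewrite ffunE.
have sub : [set t | transversal A' t] \subset
    [set t | addable E D t && transversal A t] :|: \bigcup_(p | p.1 != p.2) B p.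
  apply/fintype.subsetP => t; rewrite !inE => /forallP tA.
  have tAi i : (t i \in A i) /\ (degree E (t i) < D)%N.
    by have := tA i; rewrite ffunE !inE => /andP.
  have [_|] := boolP (addable E D t) => /=.
    by apply/orP; left; apply/forallP => i; case: (tAi i).
  rewrite negb_and => /orP[/forallPn[i]|].
    by rewrite (tAi i).2.
  move=> /forallPn[i /forallPn[j]]; rewrite negb_imply negbK => /andP[ij tj].
  by apply/bigcupP; exists (i, j) => //; rewrite inE.
apply: leq_trans (leq_mul (subset_leq_card sub) (leqnn _)) _.
apply: leq_trans (leq_mul (leq_card_setU _ _) (leqnn _)) _.
rewrite mulnDl leq_add2l.
apply: (@leq_trans (\sum_(p : 'I_r * 'I_r | p.1 != p.2) (#|B p| * #|T|))%N).
  rewrite -big_distrl leq_mul2r; apply/orP; right.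
  exact: card_bigcup_le_sum.
apply: (@leq_trans (\sum_(p : 'I_r * 'I_r | p.1 != p.2) (b * #|T| ^ r))%N).
  by apply: leq_sum => p ij; exact: card_related_coords.
rewrite sum_nat_const leq_mul2r; apply/orP; right.
by apply: leq_trans (max_card _) _; rewrite card_prod card_ord.
Qed.

End Sparse.

(** * Greedy selection of the edges *)

Lemma expr_half_le1 (R : realType) (eta : R) n :
  0 < eta -> eta <= 1 -> (eta / 2) ^+ n <= 1.
Proof. by move=> ? ?; apply: exprn_ile1; lra. Qed.

Section Greedy.
Context {R : realType} {T : finType} (r : nat) (eta : R).
Local Notation N := (#|T|%:R : R).
(** Each set keeps at least [eta/2 N] unsaturated vertices, which gives [4 c N^r] transversals. At
    most half of that number fail to be addable; the last factor 2 makes the averaging in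
    [greedy_step] strict. *)
Local Notation c := ((eta / 2) ^+ r / 4).
Hypotheses (r0 : (0 < r)%N) (eta0 : 0 < eta) (eta1 : eta <= 1) (T0 : (0 < #|T|)%N).

(** The families of dense sets still to be served; the greedy choice shrinks this collection
    geometrically. *)
Definition unhit (E : {set {set T}}) : {set {ffun 'I_r -> {set T}}} :=
  [set A : {ffun 'I_r -> {set T}} |
    [forall i : 'I_r, eta * N <= #|A i|%:R] && ~~ hits E A].

Variable D : nat.
Hypothesis D0 : (0 < D)%N.
Hypothesis TD : (r ^ 2 * ((D * r) ^ 2).+1)%:R <= 2 * c * N.

Let N0 : 0 < N. Proof. by rewrite ltr0n. Qed.
Let c0 : 0 < c. Proof. by rewrite divr_gt0// exprn_gt0// divr_gt0. Qed.

Lemma many_addable E (A : {ffun 'I_r -> {set T}}) : sparse E r D ->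
  (#|E| * r)%:R <= eta / 2 * N * D%:R ->
  (forall i, eta * N <= #|A i|%:R) ->
  2 * c * N ^+ r <= #|[set t | addable E D t && transversal A t]|%:R.
Proof.
move=> spE small Abig; have [unif tri deg] := spE.
pose low := [set x | (degree E x < D)%N].
(* Double counting: each vertex outside [low] has degree at least [D], and the degrees add up to
   [#|E| * r]. *)
have sat : (D * #|~: low| <= #|E| * r)%N.
  rewrite -(sum_degree unif) mulnC -sum_nat_const [leqRHS](bigID (mem (~: low))) /=.
  apply: leq_trans (leq_addr _ _); apply: leq_sum => x.
  by rewrite !inE -leqNgt.
have lowbig i : eta / 2 * N <= #|A i :&: low|%:R.
  have satR : #|~: low|%:R <= eta / 2 * N.
    rewrite -(ler_pM2r (_ : 0 < D%:R)) ?ltr0n// (le_trans _ small)//.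
    by rewrite -natrM ler_nat mulnC.
  have : #|A i|%:R <= #|A i :&: low|%:R + #|~: low|%:R :> R.
    rewrite -natrD ler_nat -(cardsID low (A i)) leq_add2l subset_leq_card//.
    by rewrite finset.setDE finset.subsetIr.
  have := Abig i; lra.
have := card_addable A r0 spE; rewrite -/low -(ler_nat R) natrD !natrM => count.
rewrite -(ler_pM2r N0) -(lerD2r (2 * c * N * N ^+ r)).
have lhs : 2 * c * N ^+ r * N + 2 * c * N * N ^+ r <=
    (\prod_i #|A i :&: low|)%:R * N.
  have -> : 2 * c * N ^+ r * N + 2 * c * N * N ^+ r = (eta / 2 * N) ^+ r * N.
    rewrite [(eta / 2 * N) ^+ r]exprMn.
    by move: ((eta / 2) ^+ r) (N ^+ r) => p q; field.
  rewrite ler_pM2r// natr_prod -[X in _ ^+ X]card_ord -prodr_const.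
  by apply: ler_prod => i _; rewrite lowbig andbT mulr_ge0 ?divr_ge0// ltW.
apply: (le_trans lhs (le_trans count _)); rewrite lerD2l natrX mulrA -natrM.
by rewrite -natrM mulnn ler_pM2r ?exprn_gt0.
Qed.

(* By averaging, some addable edge lies in a fraction at least [c] of the
   families of sets that have no transversal edge yet. *)
Lemma greedy_step E : sparse E r D -> (#|E| * r)%:R <= eta / 2 * N * D%:R ->
  exists E', [/\ sparse E' r D, (#|E'| <= #|E|.+1)%N &
    #|unhit E'|%:R <= (1 - c) * #|unhit E|%:R].
Proof.
move=> spE small; set U := unhit E.
have [U0|U0] := posnP #|U|; first by exists E; rewrite -/U U0 mulr0.
pose H (t : {ffun 'I_r -> T}) := [set A in U | transversal A t].
have [t addt Ht] : exists2 t, addable E D t & c * #|U|%:R <= #|H t|%:R.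
  apply: contrapT => /forall2NP none.
  have count : \sum_(A in U) #|[set t | addable E D t && transversal A t]|%:R =
      \sum_(t | addable E D t) #|H t|%:R :> R.
    rewrite -!natr_sum; congr (_%:R).
    transitivity (\sum_(A in U) \sum_(t | addable E D t) (transversal A t : nat))%N.
      apply: eq_bigr => A _; rewrite -sum1_card big_mkcond [RHS]big_mkcond.
      by apply: eq_bigr => t _; rewrite inE; case: addable; case: transversal.
    rewrite exchange_big; apply: eq_bigr => t _.
    rewrite -sum1_card big_mkcond [RHS]big_mkcond.
    by apply: eq_bigr => A _; rewrite [A \in H t]inE; case: (A \in U); case: transversal.
  have lower : #|U|%:R * (2 * c * N ^+ r) <=
      \sum_(A in U) #|[set t | addable E D t && transversal A t]|%:R.
    rewrite mulr_natl -sumr_const; apply: ler_sum => A.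
    by rewrite /U /unhit inE => /andP[/forallP Abig _]; exact: many_addable.
  have upper : \sum_(t | addable E D t) #|H t|%:R <= #|U|%:R * (c * N ^+ r).
    apply: (@le_trans _ _ (\sum_(t : {ffun 'I_r -> T}) c * #|U|%:R)).
      rewrite [leLHS]big_mkcond; apply: ler_sum => t _.
      case: ifPn => [addt|_]; last by rewrite mulr_ge0// ltW.
      by have [//|/negP] := none t; rewrite -ltNge => /ltW.
    rewrite sumr_const card_ffun card_ord -[leLHS]mulr_natl natrX.
    by rewrite le_eqVlt; apply/orP; left; apply/eqP; ring.
  have pos : 0 < #|U|%:R * (c * N ^+ r) by rewrite mulr_gt0 ?ltr0n// mulr_gt0 ?exprn_gt0.
  move: lower; rewrite count => /le_trans/(_ upper); lra.
exists (edge_of t |: E); split; first exact: sparse_add addt.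
  by rewrite cardsU1 -add1n leq_add2r leq_b1.
have sub : unhit (edge_of t |: E) \subset U :\: H t.
  apply/fintype.subsetP => A; rewrite /U !inE => /andP[->] nohit /=.
  have -> /= : ~~ hits E A.
    apply: contra nohit => /existsP[t' /andP[At' Et']].
    by apply/existsP; exists t'; rewrite At' inE Et' orbT.
  rewrite andbT; apply: contra nohit => At.
  by apply/existsP; exists t; rewrite At setU11.
have sH : H t \subset U by apply/fintype.subsetP => A; rewrite inE => /andP[].
apply: (@le_trans _ _ #|U :\: H t|%:R); first by rewrite ler_nat subset_leq_card.
by rewrite cardsDS// natrB ?subset_leq_card//; lra.
Qed.

Lemma greedy q : (q * r)%:R <= eta / 2 * N * D%:R ->
  exists2 E, sparse E r D & #|unhit E|%:R <= (1 - c) ^+ q * (2 ^+ r) ^+ #|T|.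
Proof.
move=> small; suff [E [spE _ UE]] : exists E, [/\ sparse E r D, (#|E| <= q)%N &
    #|unhit E|%:R <= (1 - c) ^+ q * (2 ^+ r) ^+ #|T|] by exists E.
elim: q small => [|q IH] small.
  exists finset.set0; split; rewrite ?cards0//; last first.
    apply: le_trans (_ : #|{: {ffun 'I_r -> {set T}}}|%:R <= _).
      by rewrite ler_nat max_card.
    rewrite card_ffun card_ord -cardsT -powersetT card_powerset cardsT mul1r.
    by rewrite -expnM !natrX -exprM mulnC.
  split=> [f|e f g a b d|x]; rewrite ?inE//.
  rewrite /degree (_ : [set f in _ | _] = finset.set0) ?cards0//.
  by apply/setP => f; rewrite !inE.
have [|E [spE Eq UE]] := IH.
  by apply: le_trans small; rewrite ler_nat leq_mul2r leqnSn orbT.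
have [|E' [spE' Eq' UE']] := greedy_step spE.
  by apply: le_trans small; rewrite ler_nat leq_mul2r (leq_trans Eq) ?leqnSn ?orbT.
exists E'; split; rewrite ?(leq_trans Eq')//.
have c1 : c <= 1.
  by have := expr_half_le1 r eta0 eta1; move: (_ ^+ r) => p; lra.
by apply: le_trans UE' _; rewrite exprS -mulrA ler_wpM2l// subr_ge0.
Qed.

End Greedy.

Lemma expr_onem_le (R : realType) (c : R) n : 0 <= c <= 1 ->
  (1 - c) ^+ n * (1 + n%:R * c) <= 1.
Proof.
move=> /andP[c0 c1]; elim: n => [|n IH]; first by rewrite expr0 mul0r; lra.
apply: le_trans IH; rewrite exprSr -mulrA ler_wpM2l ?exprn_ge0 ?subr_ge0//.
rewrite -[n.+1%:R]natr1 -subr_ge0.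
have -> : 1 + n%:R * c - (1 - c) * (1 + (n%:R + 1) * c) = (n%:R + 1) * c ^+ 2 by ring.
by rewrite mulr_ge0 ?sqr_ge0// addr_ge0.
Qed.

Lemma sparse_hypergraph (R : realType) (r : nat) (eta : R) :
  (0 < r)%N -> 0 < eta -> eta <= 1 ->
  exists N0, forall T : finType, (N0 <= #|T|)%N -> exists E : {set {set T}},
    [/\ forall e, e \in E -> #|e| = r, triangle_free E &
     forall A : 'I_r -> {set T}, (forall i, eta * #|T|%:R <= #|A i|%:R) ->
     exists t : 'I_r -> T, [/\ injective t, forall i, t i \in A i &
                            [set t i | i : 'I_r] \in E]].
Proof.
move=> r0 eta0 eta1; pose c := (eta / 2) ^+ r / 4.
have c0 : 0 < c by rewrite divr_gt0// exprn_gt0// divr_gt0.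
have c1 : c <= 1.
  have := expr_half_le1 r eta0 eta1.
  by rewrite /c; lra.
(* There are [(2^r)^#|T|] families at the start, so with [(1 - c)^K 2^r < 1] fewer than one is left
   after [K #|T|] steps. *)
pose K := (Num.truncn (2 ^+ r / c)).+1.
have Kc : 2 ^+ r < K%:R * c by rewrite -ltr_pdivrMr// truncnS_gt.
have K1 : (1 - c) ^+ K * 2 ^+ r < 1.
  have := @expr_onem_le R c K; rewrite (ltW c0) c1 => /(_ isT).
  apply: contraLR; rewrite -leNgt -ltNge => big.
  have K0 : 0 < (1 - c) ^+ K.
    by rewrite -(pmulr_lgt0 _ (_ : 0 < 2 ^+ r)) ?exprn_gt0// (lt_le_trans _ big).
  by apply: le_lt_trans big _; rewrite ltr_pM2l//; lra.
(* [D] is so large that [K #|T|] edges saturate at most [eta/2 #|T|] vertices. *)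
pose D := (Num.truncn (2 * (K * r)%:R / eta)).+1.
have KD : (K * r)%:R <= eta / 2 * D%:R.
  have : 2 * (K * r)%:R / eta < D%:R by rewrite truncnS_gt.
  by rewrite ltr_pdivrMr//; lra.
exists (Num.truncn ((r ^ 2 * ((D * r) ^ 2).+1)%:R / (2 * c))).+1 => T TN.
have T0 : (0 < #|T|)%N by exact: leq_trans TN.
have TD : (r ^ 2 * ((D * r) ^ 2).+1)%:R <= 2 * c * #|T|%:R.
  have c20 : 0 < 2 * c by apply: mulr_gt0.
  rewrite [leRHS]mulrC -ler_pdivrMr//.
  apply: le_trans (ltW (truncnS_gt _)) _.
  by rewrite ler_nat.
have [|E [unif tri _] UE] := @greedy R T r eta r0 eta0 eta1 T0 D isT TD (K * #|T|).
  by rewrite mulnAC natrM [leRHS]mulrAC ler_wpM2r.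
exists E; split=> // A bigA; pose A' : {ffun 'I_r -> {set T}} := [ffun i => A i].
have U0 : unhit r eta E = finset.set0 :> {set {ffun 'I_r -> {set T}}}.
  apply/eqP; rewrite -cards_eq0 -leqn0 -ltnS -(ltr_nat R); apply: le_lt_trans UE _.
  rewrite exprM -exprMn exprn_ilt1// ?mulr_ge0 ?exprn_ge0 ?subr_ge0//.
  by rewrite -lt0n.
have : A' \notin unhit r eta E by rewrite U0 inE.
rewrite inE negb_and negbK => /orP[/forallPn[i]|]; first by rewrite ffunE bigA.
move=> /existsP[t /andP[/forallP At Et]]; exists t; split=> //.
  have /imset_injP tinj : #|[set t i | i in 'I_r]| == #|'I_r|.
    by rewrite card_ord; apply/eqP; exact: unif.
  by move=> i j; exact: tinj.
by move=> i; have := At i; rewrite ffunE.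
Qed.

(** * Amalgamation of the parts *)

Lemma RT_ge (R : realType) (r n : nat) (H : Defs.family) (a : R) (V : finType)
    (G : hypergraph V) :
  #|V| = n -> uniform r G -> family_free H G ->
  (independence_number G)%:R <= a -> (#|G| <= RT r n H a)%N.
Proof.
move=> Vn uG fG iG.
pose f (x : V) : 'I_n := cast_ord Vn (enum_rank x).
pose g (i : 'I_n) : V := enum_val (cast_ord (esym Vn) i).
have fK : cancel f g by move=> x; rewrite /g /f cast_ordK enum_rankK.
have gK : cancel g f by move=> i; rewrite /g /f enum_valK cast_ordKV.
have fI := can_inj fK; have gI := can_inj gK.
pose G' : hypergraph 'I_n := [set f @: (e : {set V}) | e in G].
have gf (e : {set V}) : g @: (f @: e) = e.
  by rewrite -imset_comp -[RHS]imset_id; apply: eq_imset => x; exact: fK.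
have -> : #|G| = #|G'| by rewrite card_imset//; exact: imset_inj.
apply: leq_bigmax_cond; apply/asboolP; split.
- apply/forall_inP => _ /imsetP[e eG ->]; rewrite card_imset//.
  by move/forall_inP: uG; exact.
- move=> U F HF [h [hI hF]]; apply: (fG U F HF); exists (g \o h); split.
    exact: inj_comp.
  move=> e /hF /imsetP[e' e'G he]; rewrite imset_comp he.
  by rewrite gf.
- apply: le_trans iG; rewrite ler_nat; apply/bigmax_leqP => A indA.
  rewrite -(card_imset _ gI).
  apply: (@leq_bigmax_cond _ _ (fun B : {set V} => #|B|) (g @: A)).
  apply/forall_inP => e eG; apply: contraTN indA => eA; apply/forall_inPn.
  exists (f @: e); first exact: imset_f.
  rewrite negbK; apply/fintype.subsetP => _ /imsetP[x xe ->].
  by have /imsetP[y yA ->] := fintype.subsetP eA _ xe; rewrite gK.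
Qed.

Lemma TK_edge_exists r s (i j : 'I_s) : i != j -> exists p : core_pair s,
  forall l, (inl l \in TK_edge r p) = (l == i) || (l == j).
Proof.
have key (a b : 'I_s) : (a < b)%N -> exists p : core_pair s,
    forall l, (inl l \in TK_edge r p) = (l == a) || (l == b).
  move=> ab; exists (Sub (a, b) ab) => l; rewrite !inE.
  by case: imsetP => [[]//|_]; rewrite orbF.
rewrite -val_eqE neq_ltn => /orP[/key//|/key[p Hp]]; exists p => l.
by rewrite Hp orbC.
Qed.

Section Amalgam.
Variables (r s : nat) (T : finType) (E : {set {set T}}).
(** [near] governs pairs in different parts and [good] pairs in the same part; [near_good] below is
    the only link between them. *)
Variables (near : 'I_r -> 'I_r -> rel T) (good : 'I_r -> rel T).

Local Notation V := ('I_r * T + 'I_s)%type.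
Implicit Types (i j : 'I_r) (x y : T) (e : {set T}) (A S : {set V}).

Definition in_part i e : {set V} := [set inl (i, x) | x in e].

Definition across (t : {ffun 'I_r -> T}) : {set V} := [set inl (i, t i) | i : 'I_r].

Definition good_edge i e :=
  [forall x in e, forall y in e, (x != y) ==> good i x y].

Definition near_tuple (t : {ffun 'I_r -> T}) :=
  [forall i : 'I_r, forall j : 'I_r, (i < j)%N ==> near i j (t i) (t j)].

(* The vertices [inr m] are isolated: they only adjust the order of the graph. *)
Definition amalgam : hypergraph V :=
  [set A | [exists i, exists e, [&& e \in E, good_edge i e & A == in_part i e]] ||
           [exists t, near_tuple t && (A == across t)]].

Definition part i S : {set T} := [set x | inl (i, x) \in S].

Lemma mem_in_part i j x e : (inl (i, x) \in in_part j e) = (i == j) && (x \in e).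
Proof.
apply/imsetP/andP => [[y ye [-> ->]]|[/eqP-> xe]]; first by rewrite eqxx.
by exists x.
Qed.

Lemma mem_across i x t : (inl (i, x) \in across t) = (x == t i).
Proof. by apply/imsetP/eqP => [[j _ [-> ->]]|->]; last by exists i. Qed.

Variant amalgam_spec A : Prop :=
  | AmalgamIn i e of e \in E & good_edge i e & A = in_part i e
  | AmalgamAcross t of near_tuple t & A = across t.

Lemma amalgamP A : A \in amalgam -> amalgam_spec A.
Proof.
rewrite inE => /orP[/existsP[i /existsP[e /and3P[eE ge /eqP->]]]|].
  exact: AmalgamIn eE ge _.
by move=> /existsP[t /andP[nt /eqP->]]; exact: AmalgamAcross nt _.
Qed.

Lemma amalgam_same A i x y : A \in amalgam -> inl (i, x) \in A -> inl (i, y) \in A ->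
  x != y -> exists e, [/\ e \in E, A = in_part i e, x \in e, y \in e & good i x y].
Proof.
move=> /amalgamP[j e eE /forall_inP ge ->|t _ ->]; last first.
  by rewrite !mem_across => /eqP-> /eqP->; rewrite eqxx.
rewrite !mem_in_part => /andP[/eqP-> xe] /andP[_ ye] xy; exists e; split=> //.
by have /forall_inP/(_ _ ye) := ge _ xe; rewrite xy.
Qed.

Lemma amalgam_diff A i j x y : A \in amalgam -> inl (i, x) \in A -> inl (j, y) \in A ->
  (i < j)%N -> near i j x y.
Proof.
move=> /amalgamP[l e _ _ ->|t nt ->].
  by rewrite !mem_in_part => /andP[/eqP-> _] /andP[/eqP-> _]; rewrite ltnn.
rewrite !mem_across => /eqP-> /eqP-> ij.
by have /forallP/(_ i)/forallP/(_ j) := nt; rewrite ij.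
Qed.

Lemma amalgam_inr A (m : 'I_s) : A \in amalgam -> inr m \notin A.
Proof.
by move=> /amalgamP[l e _ _ ->|t nt ->]; apply/negP => /imsetP[].
Qed.

Hypothesis unif : forall e, e \in E -> #|e| = r.

Lemma amalgam_uniform : uniform r amalgam.
Proof.
apply/forall_inP => A /amalgamP[i e eE _ ->|t _ ->]; apply/eqP.
  by rewrite card_imset ?unif// => x y [].
by rewrite card_imset ?card_ord// => i j [].
Qed.

Lemma card_amalgam : (#|[set t | near_tuple t]| <= #|amalgam|)%N.
Proof.
have acrossI : injective across.
  move=> t t' tt'; apply/ffunP => i; apply/eqP.
  by rewrite -mem_across -tt' mem_across.
rewrite -(card_imset _ acrossI); apply: subset_leq_card.
apply/fintype.subsetP => A /imsetP[t]; rewrite inE => nt ->; rewrite inE.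
by apply/orP; right; apply/existsP; exists t; rewrite nt eqxx.
Qed.

Lemma card_parts S : (#|S| <= \sum_i #|part i S| + s)%N.
Proof.
have sub : S \subset (\bigcup_i in_part i (part i S)) :|: [set inr m | m : 'I_s].
  apply/fintype.subsetP => -[[i x]|m] xS; rewrite inE; apply/orP; [left|right].
    by apply/bigcupP; exists i; rewrite // mem_in_part eqxx inE.
  exact: imset_f.
apply: leq_trans (subset_leq_card sub) _.
apply: leq_trans (leq_card_setU _ _) _; apply: leq_add; last first.
  by rewrite card_imset ?card_ord// => m m' [].
apply: leq_trans (card_bigcup_le_sum _ _) _.
by apply: leq_sum => i _; exact: leq_imset_card.
Qed.

Lemma amalgam_independence (b : nat) :
  (forall i (B : {set T}), (b < #|B|)%N ->
     exists2 e, e \in E & good_edge i e && (e \subset B)) ->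
  (independence_number amalgam <= r * b + s)%N.
Proof.
move=> hitB; apply/bigmax_leqP => S indS; apply: leq_trans (card_parts S) _.
rewrite leq_add2r -[X in (_ <= X * _)%N]card_ord -sum_nat_const.
apply: leq_sum => i _; rewrite leqNgt; apply/negP => big.
have [e eE /andP[ge eS]] := hitB i _ big.
have /forall_inP/(_ (in_part i e)) := indS; rewrite inE.
have -> : [exists i0, exists e0,
    [&& e0 \in E, good_edge i0 e0 & in_part i e == in_part i0 e0]].
  by apply/existsP; exists i; apply/existsP; exists e; rewrite eE ge eqxx.
move=> /(_ isT)/negP; apply; apply/fintype.subsetP => _ /imsetP[x xe ->].
by have := fintype.subsetP eS _ xe; rewrite inE.
Qed.

Definition covered S := forall v w, v \in S -> w \in S -> v != w ->
  exists2 A, A \in amalgam & (v \in A) && (w \in A).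

Lemma covered_same S i x y : covered S -> x \in part i S -> y \in part i S ->
  x != y -> exists2 e, e \in E & [/\ x \in e, y \in e & good i x y].
Proof.
move=> cov; rewrite !inE => xS yS xy.
have [|A AG /andP[xA yA]] := cov _ _ xS yS.
  by rewrite (inj_eq (@inl_inj _ _)) xpair_eqE eqxx.
by have [e [eE _ xe ye ge]] := amalgam_same AG xA yA xy; exists e.
Qed.

Hypothesis near_good : forall i j x y x' y', (i < j)%N ->
  good i x y -> good j x' y' ->
  near i j x x' -> near i j x y' -> near i j y x' -> near i j y y' -> False.

Lemma covered_one_big_part S i j : covered S -> (i < j)%N ->
  (1 < #|part i S|)%N -> (1 < #|part j S|)%N -> False.
Proof.
move=> cov ij /card_gt1P[x [y [xS yS xy]]] /card_gt1P[x' [y' [xS' yS' xy']]].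
have [_ _ [_ _ gi]] := covered_same cov xS yS xy.
have [_ _ [_ _ gj]] := covered_same cov xS' yS' xy'.
have nij v w : v \in part i S -> w \in part j S -> near i j v w.
  rewrite !inE => vS wS; have [|A AG /andP[vA wA]] := cov _ _ vS wS.
    by rewrite (inj_eq (@inl_inj _ _)) xpair_eqE -val_eqE ltn_eqF.
  exact: amalgam_diff AG vA wA ij.
exact: near_good ij gi gj (nij _ _ xS xS') (nij _ _ xS yS') (nij _ _ yS xS') (nij _ _ yS yS').
Qed.

(** At most one part has several vertices of [S]; it contributes at most [q], and the other [r - 1]
    parts at most one each. *)
Lemma covered_card S q : covered S -> (1 < #|S|)%N -> (0 < q)%N ->
  (forall i, #|part i S| <= q)%N -> (#|S| < q + r)%N.
Proof.
move=> cov S1 q0 Sq.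
(* Isolated vertices lie in no edge, so none belongs to a covered set of size at least 2. *)
have Sinl v : v \in S -> exists i x, v = inl (i, x).
  move=> vS; have [w wS vw] : exists2 w, w \in S & v != w.
    have /card_gt1P[x [y [xS yS xy]]] := S1.
    by have [vx|vx] := eqVneq v x; [exists y; rewrite ?vx|exists x].
  have [A AG /andP[vA _]] := cov _ _ vS wS vw.
  case: v vA {vS vw} => [[i x] _|m vA]; first by exists i, x.
  by have := amalgam_inr m AG; rewrite vA.
have cS : (#|S| <= \sum_i #|part i S|)%N.
  have sub : S \subset (\bigcup_i in_part i (part i S)).
    apply/fintype.subsetP => v vS; have [i [x vE]] := Sinl v vS; subst v.
    by apply/bigcupP; exists i; rewrite // mem_in_part eqxx inE.
  apply: leq_trans (subset_leq_card sub) _.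
  apply: leq_trans (card_bigcup_le_sum _ _) _.
  by apply: leq_sum => i _; exact: leq_imset_card.
have /card_gt1P[v [_ [vS _ _]]] := S1; have [i1 [_ _]] := Sinl v vS.
have [i0 small] : exists i0, forall i, i != i0 -> (#|part i S| <= 1)%N.
  have [/existsP[i0 big]|/existsPn small] := boolP [exists i, (1 < #|part i S|)%N].
    exists i0 => i; rewrite leqNgt -val_eqE neq_ltn => ii0; apply/negP => bigi.
    by case/orP: ii0 => ii0; apply: (covered_one_big_part cov ii0).
  by exists i1 => i _; rewrite leqNgt; exact: small.
apply: leq_ltn_trans cS _; rewrite (bigD1 i0)//=.
apply: (@leq_ltn_trans (q + \sum_(i < r | i != i0) 1)%N).
  by rewrite leq_add//; apply: leq_sum => i; exact: small.
rewrite ltn_add2l sum1_card; have := cardC1 i0; rewrite card_ord => ->.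
by rewrite prednK// (leq_ltn_trans _ (ltn_ord i0)).
Qed.

Hypothesis tri : triangle_free E.

(** If [a] and [b] lie in the edge [e], a third vertex forms a triangle of edges with them and hence
    lies in [e] too. *)
Lemma covered_part S i : (0 < r)%N -> covered S -> (#|part i S| <= r)%N.
Proof.
move=> r0 cov; have [|] := leqP #|part i S| 1; first by move=> /leq_trans; exact.
case/card_gt1P=> a [b [aS bS ab]].
have [e eE [ae be _]] := covered_same cov aS bS ab.
rewrite -(unif eE); apply: subset_leq_card; apply/fintype.subsetP => c cS.
have [->//|ca] := eqVneq c a; have [->//|cb] := eqVneq c b.
rewrite eq_sym in ca; rewrite eq_sym in cb.
have [f fE [bf cf _]] := covered_same cov bS cS cb.
have [g gE [ag cg _]] := covered_same cov aS cS ca.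
by rewrite (tri eE fE gE ab cb ca).
Qed.

Lemma amalgam_TK_family_free : (1 < r)%N -> family_free (TK_family r (2 * r)) amalgam.
Proof.
move=> r1 U F [_ [S0 [cS0 cov0]]] [f [fI fF]]; have r0 := ltnW r1.
pose S : {set V} := f @: S0.
have cov : covered S.
  move=> _ _ /imsetP[x xS ->] /imsetP[y yS ->] xy.
  have [|e eF /andP[xe ye]] := cov0 x y xS yS; first by apply: contraNneq xy => ->.
  by exists (f @: e); [exact: fF|rewrite !imset_f].
have cS : #|S| = (r + r)%N by rewrite card_imset// cS0 mul2n addnn.
have := @covered_card S r cov; rewrite cS ltnn => H; suff : false by [].
by apply: H => // [|i]; [lia|exact: covered_part].
Qed.

Lemma amalgam_TK_free : (1 < r)%N -> family_free (TK_single r r.+2) amalgam.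
Proof.
move=> r1 U F HF [f [fI fF]].
case: {U F} HF f fI fF => f fI fF; have r0 := ltnW r1.
pose core (j : 'I_r.+2) : TK_vertex r r.+2 := inl j.
have coreI : injective core by move=> i j [].
pose S : {set V} := [set f (core j) | j : 'I_r.+2].
(* An edge of [TK] through two core vertices contains no third one; this will exclude three core
   vertices in one part. *)
have edge_of (i j : 'I_r.+2) : i != j -> exists A, [/\ A \in amalgam,
    f (core i) \in A, f (core j) \in A &
    forall l, f (core l) \in A -> l = i \/ l = j].
  move=> /(TK_edge_exists r)[p Hp]; exists (f @: TK_edge r p); split.
  - by apply: fF; rewrite /TK imset_f.
  - by rewrite imset_f// Hp eqxx.
  - by rewrite imset_f// Hp eqxx orbT.
  - move=> l; rewrite mem_imset// Hp => /orP[]/eqP; by [left|right].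
have cov : covered S.
  move=> _ _ /imsetP[i _ ->] /imsetP[j _ ->] ij.
  have [|A [AG iA jA _]] := @edge_of i j; first by apply: contraNneq ij => ->.
  by exists A; rewrite ?iA.
have cS : #|S| = r.+2.
  by rewrite card_imset ?card_ord// => i j /fI /coreI.
have := @covered_card S 2 cov; rewrite cS !add2n ltnn => H; suff : false by [].
apply: H => // m; rewrite leqNgt; apply/negP.
case/card_gt2P => a [b [c [[aS bS cS'] [ab bc ca]]]].
move: aS bS cS'; rewrite !inE => /imsetP[i _ ai] /imsetP[j _ bj] /imsetP[l _ cl].
have ij : i != j by apply: contraNneq ab => ij; move: ai; rewrite ij -bj => -[->].
have jl : j != l by apply: contraNneq bc => jl; move: bj; rewrite jl -cl => -[->].
have il : i != l by apply: contraNneq ca => il; move: ai; rewrite il -cl => -[->].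
rewrite eq_sym in ca.
have [A [AG iA jA Aonly]] := edge_of _ _ ij.
have [B [BG jB lB _]] := edge_of _ _ jl.
have [C [CG iC lC _]] := edge_of _ _ il.
rewrite -ai -bj in iA jA; rewrite -bj -cl in jB lB; rewrite -ai -cl in iC lC.
have [e [eE AE ae be _]] := amalgam_same AG iA jA ab.
have [g [gE _ bg cg _]] := amalgam_same BG jB lB bc.
have [h [hE _ ah ch _]] := amalgam_same CG iC lC ca.
have eg := tri eE gE hE ab bc ca ae be bg cg ah ch.
have : f (core l) \in A by rewrite AE -cl mem_in_part eqxx eg.
by move=> /Aonly[] li; [rewrite li eqxx in il|rewrite li eqxx in jl].
Qed.

End Amalgam.

(** * A Bollobas-Erdos graph on the cube *)

Section AvgProduct.
Context {R : realType} {I Z : finType}.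

Lemma avg_prod_ffun (g : I -> Z -> R) :
  avg (fun w : {ffun I -> Z} => \prod_i g i (w i)) = \prod_i avg (g i).
Proof.
rewrite /avg big_split /= bigA_distr_bigA /= prodr_const card_ffun natrX exprVn.
by [].
Qed.

Lemma avg_coord2 (f : Z -> Z -> R) (i j : I) : i != j ->
  avg (fun w : {ffun I -> Z} => f (w i) (w j)) = avg (fun p : Z * Z => f p.1 p.2).
Proof.
move=> ij; have ji : (j == i) = false by rewrite eq_sym (negPf ij).
(* The product of [g p l (w l)] over [l] is the indicator of [(w i, w j) = p], in the form that
   [avg_prod_ffun] factorizes. *)
pose g (p : Z * Z) (l : I) (z : Z) : R :=
  if l == i then (z == p.1)%:R else if l == j then (z == p.2)%:R else 1.
have avg1 (z : Z) : avg (fun z' => (z' == z)%:R : R) = #|Z|%:R^-1.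
  rewrite avg_pred (_ : [set z' | z' == z] = [set z]) ?cards1 ?mul1r//.
  by apply/setP => z'; rewrite !inE.
transitivity (avg (fun w : {ffun I -> Z} =>
    \sum_(p : Z * Z) f p.1 p.2 * \prod_l g p l (w l))).
  apply: eq_avg => w; rewrite (bigD1 (w i, w j))//= [X in _ + X]big1 => [|p pw].
    rewrite addr0 big1 ?mulr1// => l _; rewrite /g.
    by case: eqP => [->|_]; [rewrite eqxx|case: eqP => [->|//]; rewrite eqxx].
  rewrite (bigD1 i)//= (bigD1 j) ?ji//= /g !eqxx ji.
  have [wi|_] := eqVneq (w i) p.1; last by rewrite /= mulr0n mul0r mulr0.
  have [wj|_] := eqVneq (w j) p.2; last by rewrite /= mulr0n mul0r !mulr0.
  by move: pw; rewrite wi wj -surjective_pairing eqxx.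
rewrite avg_sum /avg mulr_suml; apply: eq_bigr => p _.
rewrite -/(avg _) avgZ avg_prod_ffun (bigD1 i)//= (bigD1 j) ?ji//=.
rewrite big1 => [|l /andP[li lj]]; last first.
  rewrite (eq_avg (g := fun=> 1)) ?avg_cst//; last by move=> z; rewrite /g (negPf li) (negPf lj).
  by apply/card_gt0P; exists p.1.
rewrite (eq_avg (g := fun z => (z == p.1)%:R)); last by move=> z; rewrite /g eqxx.
rewrite [X in _ * (_ * (X * _))](eq_avg (g := fun z => (z == p.2)%:R)); last first.
  by move=> z; rewrite /g ji eqxx.
by rewrite !avg1 card_prod natrM invfM mulr1.
Qed.

End AvgProduct.

Lemma sum_ord_ltn r : (\sum_(i < r) \sum_(j < r) (i < j) = 'C(r, 2))%N.
Proof.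
rewrite exchange_big -bin2_sum big_mkord; apply: eq_bigr => j _.
transitivity (\sum_(i < r | i < j) 1)%N.
  by rewrite [RHS]big_mkcond; apply: eq_bigr => i _; case: ltnP.
by rewrite -(big_ord_widen r (fun=> 1%N) (ltnW (ltn_ord j))) sum1_card card_ord.
Qed.

Section Gadget.
Context {R : realType} (r u d k m : nat) (G : R).

(* The coordinate [(i, j, (a, b))] is compared between the parts [i < j] only:
   there, [a] is the slot for part [i] and [b] the slot for part [j].  Giving
   each comparison its own coordinate makes the comparisons independent; the
   coordinates with [j <= i] are idle. *)
Definition index2 := ('I_r * 'I_r * ('I_u * 'I_u))%type.

Local Notation cube := {ffun (index2 * 'I_d) * 'I_k -> bool}.
Local Notation rows := {ffun 'I_d * 'I_k -> bool}.
Local Notation pieces := {ffun index2 -> {ffun 'I_r -> rows}}.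
Implicit Types (e : index2) (x y z : cube).

Definition inner e x y : R := \sum_i blocksum x (e, i) * blocksum y (e, i).

Definition normsum e x y : R := \sum_i (blocksum x (e, i) + blocksum y (e, i)) ^+ 2.

Definition slot (i : 'I_r) e : 'I_u := if i == e.1.1 then e.2.1 else e.2.2.

(** The factor ['I_m] blows each cube point up into [m] twins, so that the order grows while the
    cube stays fixed. *)
Definition nearby (i j : 'I_r) : rel (cube * 'I_m) := fun v w =>
  [forall a, forall b, G * k%:R < inner (i, j, (a, b)) v.1 w.1].

(** The constant [4 G] fits both uses: two points within [G k] of a common one give [2 (G + G) k],
    and half the sum of two such bounds is four times the threshold of [nearby]. *)
Definition opposed (i : 'I_r) : rel (cube * 'I_m) := fun v w =>
  [exists a, forall e, (slot i e == a) ==> (normsum e v.1 w.1 <= 4 * G * k%:R)].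

(* The four inner products add up to that of [v + w] and [v' + w'], two vectors
   which are short in the coordinate where both pairs are opposed. *)
Lemma nearby_opposed (i j : 'I_r) v w v' w' : (i < j)%N ->
  opposed i v w -> opposed j v' w' ->
  nearby i j v v' -> nearby i j v w' -> nearby i j w v' -> nearby i j w w' -> False.
Proof.
move=> ij /existsP[a /forallP ga] /existsP[b /forallP gb].
pose e : index2 := (i, j, (a, b)).
have {ga} := ga e; rewrite /slot /= eqxx /= eqxx /= => ga.
have ji : (j == i) = false by rewrite -val_eqE gtn_eqF.
have {gb} := gb e; rewrite /slot /= ji eqxx /= => gb.
move=> /forallP/(_ a)/forallP/(_ b) n1 /forallP/(_ a)/forallP/(_ b) n2.
move=> /forallP/(_ a)/forallP/(_ b) n3 /forallP/(_ a)/forallP/(_ b) n4.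
rewrite -/e in n1 n2 n3 n4.
have : inner e v.1 v'.1 + inner e v.1 w'.1 + inner e w.1 v'.1 + inner e w.1 w'.1
    <= 2^-1 * (normsum e v.1 w.1 + normsum e v'.1 w'.1).
  rewrite /inner /normsum -!big_split /= mulr_sumr; apply: ler_sum => l _.
  set p := blocksum v.1 _; set q := blocksum w.1 _.
  set p' := blocksum v'.1 _; set q' := blocksum w'.1 _.
  rewrite -subr_ge0.
  have -> : 2^-1 * ((p + q) ^+ 2 + (p' + q') ^+ 2) - (p * p' + p * q' + q * p' + q * q') =
    2^-1 * (p + q - p' - q') ^+ 2 by field.
  by rewrite mulr_ge0 ?sqr_ge0.
lra.
Qed.

(** Once the bits are regrouped by coordinate, the comparisons use disjoint sets of bits, so their
    probabilities multiply over the pairs [i < j] and the [u^2] pairs of slots. *)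
Lemma avg_nearby_tuple (c : R) : 0 <= c -> (0 < m)%N ->
  c <= avg (fun p => (G * k%:R < @dotp R d k p.1 p.2)%R%:R) ->
  c ^+ (u ^ 2 * 'C(r, 2)) <=
  avg (fun t : {ffun 'I_r -> cube * 'I_m} => (near_tuple nearby t)%:R).
Proof.
move=> c0 m0 cle.
pose ev e (y : {ffun 'I_r -> rows}) :=
  (e.1.1 < e.1.2)%N ==> (G * k%:R < dotp R (y e.1.1) (y e.1.2)).
pose h (p : pieces * {ffun 'I_r -> 'I_m}) : {ffun 'I_r -> cube * 'I_m} :=
  [ffun i => ([ffun b => p.1 b.1.1 i (b.1.2, b.2)], p.2 i)].
have h_bij : bijective h.
  exists (fun t : {ffun 'I_r -> cube * 'I_m} =>
    ([ffun e : index2 => [ffun i => [ffun b : 'I_d * 'I_k => (t i).1 ((e, b.1), b.2)]]],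
     [ffun i => (t i).2])) => [[w q]|t].
    congr pair; last by apply/ffunP => i; rewrite !ffunE.
    by apply/ffunP => e; apply/ffunP => i; apply/ffunP => -[b1 b2]; rewrite !ffunE.
  apply/ffunP => i; rewrite !ffunE [RHS]surjective_pairing; congr pair.
  by apply/ffunP => -[[e b1] b2]; rewrite !ffunE.
have innerE p i j e : inner e (h p i).1 (h p j).1 = dotp R (p.1 e i) (p.1 e j).
  rewrite /inner /dotp /blocksum; apply: eq_bigr => b _.
  by congr (_ * _); apply: eq_bigr => l _; rewrite !ffunE.
rewrite (reindex_avg _ h_bij).
rewrite (eq_avg (g := fun p : pieces * {ffun 'I_r -> 'I_m} =>
  (\prod_e (ev e (p.1 e))%:R) * 1)); last first.
  move=> p; rewrite mulr1; have [/forallP near_p|far_p] := boolP (near_tuple nearby (h p)).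
    rewrite big1// => -[[i j] [a b]] _; rewrite /ev /=; case: ltnP => //= ij.
    have /forallP/(_ j) := near_p i; rewrite ij => /forallP/(_ a)/forallP/(_ b).
    by rewrite innerE => ->.
  move: far_p => /forallPn[i /forallPn[j]]; rewrite negb_imply => /andP[ij].
  move=> /forallPn[a /forallPn[b]]; rewrite innerE => nb.
  by rewrite (bigD1 (i, j, (a, b)))//= /ev /= ij (negPf nb) mul0r.
rewrite (avg_mul (fun w : pieces => \prod_e (ev e (w e))%:R)
  (fun _ : {ffun 'I_r -> 'I_m} => 1)).
rewrite avg_cst ?mulr1; last by rewrite card_ffun card_ord expn_gt0 m0.
rewrite (avg_prod_ffun (fun e (y : {ffun 'I_r -> rows}) => (ev e y)%:R)).
have -> : c ^+ (u ^ 2 * 'C(r, 2)) =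
    \prod_(e : index2) (if (e.1.1 < e.1.2)%N then c else 1).
  rewrite -(pair_bigA _ (fun (ij : 'I_r * 'I_r) (_ : 'I_u * 'I_u) =>
    if (ij.1 < ij.2)%N then c else 1)) /=.
  rewrite (eq_bigr (fun ij : 'I_r * 'I_r => c ^+ (u ^ 2 * (ij.1 < ij.2)))).
    rewrite -(pair_bigA _ (fun i j : 'I_r => c ^+ (u ^ 2 * (i < j)))) /=.
    rewrite -sum_ord_ltn big_distrr /= expr_sum; apply: eq_bigr => i _.
    by rewrite big_distrr /= expr_sum.
  move=> ij _; rewrite prodr_const card_prod card_ord mulnn.
  by case: ltnP => _; rewrite ?muln1// muln0 expr1n.
apply: ler_prod => e _; case: (ltnP e.1.1 e.1.2) => ij; rewrite ?ler01 ?c0 /=.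
  rewrite (eq_avg (g := fun y : {ffun 'I_r -> rows} =>
    (G * k%:R < dotp R (y e.1.1) (y e.1.2))%R%:R)).
    rewrite (avg_coord2 (fun y y' : rows => (G * k%:R < dotp R y y')%R%:R))//.
    by rewrite -val_eqE ltn_eqF.
  by move=> y; rewrite /ev ij.
rewrite (eq_avg (g := fun=> 1)); last by move=> y; rewrite /ev ltnNge ij.
by rewrite avg_cst// !card_ffun !card_prod !card_ord card_bool !expn_gt0.
Qed.

Variable code : 'I_r -> {ffun 'I_u -> bool}.
Hypothesis codeI : injective code.

(* The [l]-th vertex of an edge in part [i] will be a point whose [twist i l] is
   close to a common point [z]: as [code l] and [code l'] differ in some slot,
   the [l]-th and [l']-th vertices are then opposed. *)
Definition twist (i l : 'I_r) x : cube :=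
  [ffun b => x b (+) code l (slot i b.1.1)].

Lemma twistK i l : involutive (twist i l).
Proof. by move=> x; apply/ffunP => b; rewrite !ffunE addbK. Qed.

Lemma blocksum_twist i l x c :
  blocksum (twist i l x) c = sgb R (code l (slot i c.1)) * blocksum x c.
Proof.
rewrite /blocksum mulr_sumr; apply: eq_bigr => j _.
by rewrite ffunE /= /sgb signr_addb mulrC.
Qed.

Lemma opposed_twist i l l' z (v w : cube * 'I_m) : l != l' ->
  dist2 z (twist i l v.1) < G * k%:R -> dist2 z (twist i l' w.1) < G * k%:R ->
  opposed i v w.
Proof.
move=> ll' zv zw.
have [a wa] : exists a, code l a != code l' a.
  apply/existsP; apply: contraNT ll' => /existsPn same; apply/eqP/codeI/ffunP => a.
  by apply/eqP; have := same a; rewrite negbK.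
apply/existsP; exists a; apply/forallP => e; apply/implyP => /eqP ea.
pose S (y : cube) : R := \sum_(b < d) (blocksum z (e, b) - blocksum y (e, b)) ^+ 2.
have Sle y : S y <= dist2 z y.
  have -> : dist2 z y =
      \sum_e \sum_(b < d) (blocksum z (e, b) - blocksum y (e, b)) ^+ 2 :> R.
    by rewrite pair_bigA; apply: eq_bigr => -[].
  rewrite (bigD1 e)//= lerDl sumr_ge0// => e' _; rewrite sumr_ge0// => b _.
  exact: sqr_ge0.
apply: (@le_trans _ _ (2 * (S (twist i l v.1) + S (twist i l' w.1)))); last first.
  have := Sle (twist i l v.1); have := Sle (twist i l' w.1); lra.
rewrite /normsum /S -big_split /= mulr_sumr; apply: ler_sum => b _.
rewrite !blocksum_twist /= ea.
have -> : code l' a = ~~ code l a by move: wa; case: (code l a); case: (code l' a).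
rewrite sgb_neg; have := sgb_sqr (R := R) (code l a); set s := sgb _ _ => s2.
set p := blocksum v.1 _; set q := blocksum w.1 _; set y := blocksum z _.
have -> : (p + q) ^+ 2 = (s * p - (- s * q)) ^+ 2.
  have -> : (s * p - - s * q) ^+ 2 = s ^+ 2 * (p + q) ^+ 2 by ring.
  by rewrite s2 mul1r.
rewrite -subr_ge0.
have -> : 2 * ((y - s * p) ^+ 2 + (y - - s * q) ^+ 2) - (s * p - - s * q) ^+ 2 =
  (2 * y - s * p + s * q) ^+ 2 by ring.
exact: sqr_ge0.
Qed.

(** Each twisted copy of [F] is as large as [F], so by concentration fewer than a fraction [1/r] of
    the points are far from it, and some [z] is close to all [r] copies. *)
Lemma twists_meet (i : 'I_r) (alpha t : R) (F : {set cube}) :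
  (0 < k)%N -> (#|{: index2 * 'I_d}| <= k)%N -> 0 <= t ->
  0 < alpha -> 8 * r%:R < alpha * t ^+ 2 -> alpha * #|{: cube}|%:R <= #|F|%:R ->
  exists z, forall l, exists2 x, x \in F & dist2 z (twist i l x) < (1 + t) ^+ 2 * k%:R.
Proof.
move=> k0 Ck t0 alpha0 tbig Fbig.
have r0 : (0 < r)%N by exact: leq_ltn_trans (ltn_ord i).
set N := #|{: cube}|; have N0 : (0 < N)%N by rewrite /N card_ffun card_bool expn_gt0.
pose far l := [set x | [forall a in twist i l @: F,
  (1 + t) ^+ 2 * k%:R <= dist2 x a :> R]].
have far_small l : (r * #|far l| < N)%N.
  have := @concentration R _ k k0 Ck (twist i l @: F) t t0.
  rewrite card_imset; last exact: inv_inj (twistK i l).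
  rewrite -/(far l) -/N => conc.
  have [->|far0] := posnP #|far l|; first by rewrite muln0.
  have N0R : 0 < N%:R :> R by rewrite ltr0n.
  have far0R : 0 < #|far l|%:R :> R by rewrite ltr0n.
  rewrite -(ltr_nat R) natrM -(ltr_pM2l (_ : 0 < 8))// mulrA.
  apply: (@lt_le_trans _ _ (alpha * t ^+ 2 * #|far l|%:R)); first by rewrite ltr_pM2r.
  rewrite -(ler_pM2r N0R); apply: le_trans (_ : _ <= 8 * N%:R ^+ 2) _; last first.
    by rewrite expr2 mulrA.
  apply: le_trans conc.
  have -> : alpha * t ^+ 2 * #|far l|%:R * N%:R = alpha * N%:R * (#|far l|%:R * t ^+ 2).
    by ring.
  by rewrite -[leRHS]mulrA ler_wpM2r// mulr_ge0 ?sqr_ge0.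
have [z zfar] : exists z, z \notin \bigcup_l far l.
  apply/existsP; apply: contraTT N0 => /existsPn cover.
  have allN : (N <= \sum_l #|far l|)%N.
    apply: leq_trans (card_bigcup_le_sum _ _); rewrite /N -cardsT subset_leq_card//.
    by apply/fintype.subsetP => z _; have := cover z; rewrite negbK.
  have : (r * N <= r * N.-1)%N.
    apply: leq_trans (leq_mul (leqnn r) allN) _; rewrite big_distrr /=.
    apply: leq_trans (_ : \sum_(l < r) N.-1 <= _)%N; last by rewrite sum_nat_const card_ord.
    by apply: leq_sum => l _; rewrite -ltnS (leq_trans (far_small l))// leqSpred.
  by rewrite leq_pmul2l// => NN; rewrite -leqNgt; lia.
exists z => l; have : z \notin far l.
  by apply: contra zfar => zl; apply/bigcupP; exists l.
rewrite inE => /forall_inPn[_ /imsetP[x xF ->]]; rewrite -ltNge => zx.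
by exists x.
Qed.

(** By averaging, an [alpha] fraction of the cube has fibers in [B] of density [alpha]. Among such
    points, [twists_meet] selects [x l] with twists close to a common [z], and [E] has an edge whose
    [l]-th vertex lies over [x l]. *)
Lemma dense_set_hits (i : 'I_r) (alpha t : R) (E : {set {set cube * 'I_m}})
    (B : {set cube * 'I_m}) :
  (0 < k)%N -> (#|{: index2 * 'I_d}| <= k)%N -> (0 < m)%N -> 0 <= t ->
  0 < alpha -> 8 * r%:R < alpha * t ^+ 2 -> G = (1 + t) ^+ 2 ->
  (forall A : 'I_r -> {set cube * 'I_m},
     (forall l, alpha / #|{: cube}|%:R * #|{: cube * 'I_m}|%:R <= #|A l|%:R) ->
     exists v : 'I_r -> cube * 'I_m, [/\ injective v, forall l, v l \in A l &
       [set v l | l : 'I_r] \in E]) ->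
  2 * alpha * #|{: cube * 'I_m}|%:R <= #|B|%:R ->
  exists2 e, e \in E & good_edge opposed i e && (e \subset B).
Proof.
move=> k0 Ck m0 t0 alpha0 tbig GE hitE Bbig.
set N := #|{: cube}| in hitE; have N0 : (0 < N)%N by rewrite /N card_ffun card_bool expn_gt0.
have TE : #|{: cube * 'I_m}| = (N * m)%N by rewrite card_prod card_ord.
have N0R : 0 < N%:R :> R by rewrite ltr0n.
have m0R : 0 < m%:R :> R by rewrite ltr0n.
pose fiber (x : cube) := [set v in B | v.1 == x].
pose F := [set x | alpha * m%:R <= #|fiber x|%:R].
have fiber_le x : (#|fiber x| <= m)%N.
  have pairI : injective (fun a : 'I_m => (x, a)) by move=> a b [].
  suff : (#|fiber x| <= #|[set (x, a) | a : 'I_m]|)%N by rewrite card_imset ?card_ord.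
  apply: subset_leq_card; apply/fintype.subsetP => -[y a]; rewrite inE /= => /andP[_ /eqP->].
  exact: imset_f.
have Bsum : #|B| = (\sum_x #|fiber x|)%N.
  rewrite -sum1_card (partition_big (fun v => v.1) predT)//=.
  by apply: eq_bigr => x _; rewrite -sum1_card; apply: eq_bigl => v; rewrite inE.
have Fbig : alpha * N%:R <= #|F|%:R.
  rewrite -(ler_pM2r m0R).
  have : #|B|%:R <= #|F|%:R * m%:R + N%:R * (alpha * m%:R) :> R.
    rewrite Bsum natr_sum (bigID (mem F)) /= lerD//.
      rewrite mulr_natl -sumr_const; apply: ler_sum => x _.
      by rewrite ler_nat.
    apply: (@le_trans _ _ (\sum_(x | x \notin F) (alpha * m%:R))).
      by apply: ler_sum => x; rewrite inE -ltNge => /ltW.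
    rewrite sumr_const -[leLHS]mulr_natl ler_wpM2r//; last by rewrite ler_nat max_card.
    by rewrite mulr_ge0// ltW.
  move: Bbig; rewrite TE natrM; lra.
have [z zF] := twists_meet i k0 Ck t0 alpha0 tbig Fbig.
have /choice[x xP] : forall l, exists x, x \in F /\ dist2 z (twist i l x) < G * k%:R.
  by move=> l; have [x xF zx] := zF l; exists x; rewrite GE.
have [|v [vI vx vE]] := hitE (fun l => fiber (x l)).
  move=> l; have [xF _] := xP l; rewrite inE in xF; apply: le_trans xF.
  by rewrite TE natrM mulrA divfK// gt_eqF.
exists [set v l | l : 'I_r] => //; apply/andP; split; last first.
  apply/fintype.subsetP => _ /imsetP[l _ ->]; have := vx l.
  by rewrite inE => /andP[].
have v1 l : (v l).1 = x l by have := vx l; rewrite inE => /andP[_ /eqP].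
apply/forall_inP => _ /imsetP[l _ ->]; apply/forall_inP => _ /imsetP[l' _ ->].
apply/implyP => vv; have ll' : l != l' by apply: contraNneq vv => ->.
have [_ zl] := xP l; have [_ zl'] := xP l'.
by apply: (opposed_twist ll' (z := z)); rewrite v1.
Qed.

End Gadget.

(** * The lower bound on theta *)

Lemma TK_free_construction (R : realType) (r u : nat) (eps eta : R) :
  (1 < r)%N -> (0 < u)%N -> (r <= 2 ^ u)%N -> 0 < eps -> 0 < eta -> eta <= 1 ->
  exists q n0, forall n, (n0 <= n)%N -> exists V : finType, exists H : hypergraph V,
    [/\ [/\ #|V| = n, uniform r H, family_free (TK_single r r.+2) H &
            family_free (TK_family r (2 * r)) H],
        (independence_number H)%:R <= eps * n%:R &
        ((n - q)%:R / r%:R) ^+ r * ((1 - eta) / 2) ^+ (u ^ 2 * 'C(r, 2)) <=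
        #|H|%:R].
Proof.
move=> r1 u0 ru eps0 eta0 eta1; have r0 := ltnW r1.
have rR0 : 0 < r%:R :> R by rewrite ltr0n.
(* Density [2 alpha] in a part bounds the share of the parts in an independent set by [eps n / 2];
   the other half is for the isolated vertices. *)
pose alpha : R := Num.min eps 1 / 4.
have alpha0 : 0 < alpha by rewrite divr_gt0// lt_min eps0 ltr01.
have alpha_eps : 4 * alpha <= eps.
  by rewrite /alpha mulrC divfK// ge_min lexx.
have alpha1 : alpha <= 1.
  by rewrite /alpha ler_pdivrMr// mul1r ge_min; apply/orP; right; lra.
pose t : R := 8 * r%:R / alpha + 1.
have t1 : 0 < 8 * r%:R / alpha by rewrite divr_gt0// mulr_gt0.
have t0 : 0 <= t by rewrite /t; lra.
have tbig : 8 * r%:R < alpha * t ^+ 2.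
  have -> : 8 * r%:R = alpha * (8 * r%:R / alpha) by field; rewrite gt_eqF.
  by rewrite ltr_pM2l// /t; move: (8 * r%:R / alpha) t1 => s s0; nra.
have [D HD] := @dotp_large R ((1 + t) ^+ 2) eta (sqr_ge0 _) eta0.
have D0 : (0 < D)%N by have [d dD _] := HD 1 isT; exact: leq_ltn_trans dD.
(* For every [d < D] the number of blocks is then at most [k], as concentration requires. *)
pose k := (#|{: index2 r u}| * D)%N.
have k0 : (0 < k)%N by rewrite /k !card_prod !card_ord !muln_gt0 r0 u0 D0.
have [d dD near_half] := HD k k0.
have Ck : (#|{: index2 r u * 'I_d}| <= k)%N.
  by rewrite card_prod card_ord /k leq_mul2l (ltnW dD) orbT.
have ruc : (r <= #|{: {ffun 'I_u -> bool}}|)%N by rewrite card_ffun card_bool card_ord.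
pose code (l : 'I_r) : {ffun 'I_u -> bool} := enum_val (widen_ord ruc l).
have codeI : injective code.
  by move=> l l' /enum_val_inj /(congr1 val) /= ll'; exact: val_inj.
pose P := {ffun (index2 r u * 'I_d) * 'I_k -> bool}.
have P0 : (0 < #|{: P}|)%N by rewrite card_ffun card_bool expn_gt0.
have PR0 : 0 < #|{: P}|%:R :> R by rewrite ltr0n.
have P1 : 1 <= #|{: P}|%:R :> R by rewrite ler1n.
have [||N0 HN0] := @sparse_hypergraph R r (alpha / #|{: P}|%:R) r0.
- by rewrite divr_gt0.
- by rewrite ler_pdivrMr// mul1r (le_trans alpha1).
(* The parts use the largest multiple of [q] up to [n], and fewer than [q] isolated vertices fill
   the rest; the second term of the threshold makes them at most [eps n / 2]. *)
pose q := (r * #|{: P}|)%N; have q0 : (0 < q)%N by rewrite muln_gt0 r0.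
exists q, (q * N0.+1 + (Num.truncn (2 * q%:R / eps)).+1)%N => n n0n.
pose m := (n %/ q)%N; pose s := (n %% q)%N; pose T := (P * 'I_m)%type.
have nE : n = (q * m + s)%N by rewrite mulnC /m /s -divn_eq.
have sq : (s < q)%N by rewrite ltn_mod.
have mN : (N0 < m)%N by rewrite leq_divRL// mulnC (leq_trans _ n0n)// leq_addr.
have m0 : (0 < m)%N by exact: leq_ltn_trans mN.
have cT : #|{: T}| = (#|{: P}| * m)%N by rewrite card_prod card_ord.
have rT : (r * #|{: T}| + s = n)%N by rewrite cT mulnA -/q -nE.
have [|E [unif tri hitE]] := HN0 {: T}.
  by rewrite cT (leq_trans (ltnW mN))// leq_pmull.
pose nr := @nearby R r u d k m ((1 + t) ^+ 2).
pose gd := @opposed R r u d k m ((1 + t) ^+ 2).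
have near_gd (i j : 'I_r) (x y x' y' : T) : (i < j)%N -> gd i x y -> gd j x' y' ->
    nr i j x x' -> nr i j x y' -> nr i j y x' -> nr i j y y' -> False.
  exact: nearby_opposed.
exists ('I_r * T + 'I_s)%type, (amalgam s E nr gd); split; first split.
- by rewrite card_sum card_prod !card_ord.
- exact: amalgam_uniform.
- exact: (amalgam_TK_free near_gd tri r1).
- exact: (amalgam_TK_family_free unif near_gd tri r1).
- have n0 : 2 * s%:R <= eps * n%:R.
    apply: (@le_trans _ _ (2 * q%:R)); first by rewrite ler_pM2l// ler_nat ltnW.
    rewrite [leRHS]mulrC -ler_pdivrMr// (le_trans (ltW (truncnS_gt _)))// ler_nat.
    by rewrite (leq_trans _ n0n)// leq_addl.
  pose b := Num.truncn (2 * alpha * #|{: T}|%:R).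
  have b_ge : b%:R <= 2 * alpha * #|{: T}|%:R.
    rewrite truncn_le; apply: mulr_ge0 => //; apply: mulr_ge0 => //; exact: ltW.
  apply: (@le_trans _ _ (r * b + s)%:R).
    rewrite ler_nat; apply: amalgam_independence => i B bB.
    apply: (dense_set_hits codeI i k0 Ck m0 t0 alpha0 tbig erefl hitE).
    by rewrite (le_trans (ltW (truncnS_gt _)))// ler_nat.
  rewrite natrD natrM; have : r%:R * b%:R <= r%:R * (2 * alpha * #|{: T}|%:R).
    by rewrite ler_wpM2l.
  have : r%:R * #|{: T}|%:R <= n%:R :> R by rewrite -natrM ler_nat -rT leq_addr.
  have : 0 <= r%:R * #|{: T}|%:R :> R by rewrite mulr_ge0.
  by nra.
- have := @avg_nearby_tuple R r u d k m ((1 + t) ^+ 2) ((1 - eta) / 2).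
  rewrite divr_ge0 ?subr_ge0// => /(_ isT m0 near_half); rewrite avg_pred.
  have T0 : 0 < #|{: {ffun 'I_r -> T}}|%:R :> R.
    by rewrite ltr0n card_ffun expn_gt0 cT muln_gt0 P0 m0.
  rewrite ler_pdivlMr// => count.
  apply: (@le_trans _ _ #|[set t | near_tuple nr t]|%:R); last first.
    by rewrite ler_nat; exact: card_amalgam.
  apply: le_trans count; rewrite mulrC ler_wpM2l ?exprn_ge0 ?divr_ge0 ?subr_ge0//.
  rewrite card_ffun card_ord natrX lerXn2r ?nnegrE ?divr_ge0//.
  rewrite ler_pdivrMr// -natrM ler_nat mulnC leq_subLR -rT addnC leq_add2r.
  exact: ltnW.
Qed.

Lemma bernoulli_onem (R : realType) (x : R) n : 0 <= x <= 1 ->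
  1 - n%:R * x <= (1 - x) ^+ n.
Proof.
move=> /andP[x0 x1]; elim: n => [|n IH]; first by rewrite mul0r subr0 expr0.
rewrite exprS; apply: (@le_trans _ _ ((1 - x) * (1 - n%:R * x))).
  rewrite -[n.+1%:R]natr1 -subr_ge0.
  have -> : (1 - x) * (1 - n%:R * x) - (1 - (n%:R + 1) * x) = n%:R * x ^+ 2 by ring.
  by rewrite mulr_ge0 ?sqr_ge0.
by rewrite ler_wpM2l// subr_ge0.
Qed.

Lemma theta_ge (R : realType) (r : nat) (H : Defs.family) (c : R) :
  (forall eps delta : R, 0 < eps -> 0 < delta ->
     exists n0, forall n, (n0 <= n)%N -> c - delta <= RT_ratio r H eps n) ->
  (c%:E <= theta R r H)%E.
Proof.
move=> ratio; apply: lime_ge; first exact: is_cvg_theta.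
near=> eps; have eps0 : 0 < eps by near: eps; exact: nbhs_right_gt.
apply/lee_addgt0Pr => delta delta0; rewrite limn_einf_lim -leeBlDr//.
apply: lime_ge; first exact: is_cvg_einfs.
have [n0 Hn0] := ratio eps delta eps0 delta0.
near=> n; apply: le_ereal_inf_tmp => _ [m nm <-].
rewrite -EFinB lee_fin; apply: Hn0; apply: leq_trans nm.
by near: n; exact: nbhs_infty_ge.
Unshelve. all: by end_near. Qed.

(** The hypothesis on [H] lets one construction serve both families, as it avoids both at once. *)
Lemma RT_ratio_ge (R : realType) (r u : nat) (H : Defs.family) (eps delta : R) :
  (1 < r)%N -> (0 < u)%N -> (r <= 2 ^ u)%N -> 0 < eps -> 0 < delta ->
  (forall (V : finType) (G : hypergraph V), family_free (TK_single r r.+2) G ->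
     family_free (TK_family r (2 * r)) G -> family_free H G) ->
  exists n0, forall n, (n0 <= n)%N ->
    2 ^- (u ^ 2 * 'C(r, 2)) * r%:R ^- r - delta <= RT_ratio r H eps n.
Proof.
move=> r1 u0 ru eps0 delta0 HF; set M := (u ^ 2 * 'C(r, 2))%N.
(* By Bernoulli the relative loss is at most [r q / n + M eta]; each term is kept below
   [delta / 2]. *)
pose eta : R := Num.min 1 (delta / (2 * M.+1%:R)).
have eta0 : 0 < eta by rewrite lt_min ltr01 divr_gt0// mulr_gt0.
have eta1 : eta <= 1 by rewrite ge_min lexx.
have etaM : M%:R * eta <= delta / 2.
  apply: (@le_trans _ _ (M.+1%:R * eta)); first by rewrite ler_wpM2r ?(ltW eta0)// ler_nat.
  rewrite mulrC -ler_pdivlMr//; apply: (@le_trans _ _ (delta / (2 * M.+1%:R))).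
    by rewrite ge_min lexx orbT.
  by rewrite invfM mulrA.
have [q [n0 construct]] := TK_free_construction r1 u0 ru eps0 eta0 eta1.
exists (maxn n0 (q + (Num.truncn (2 * (r * q)%:R / delta)).+1)) => n.
rewrite geq_max => /andP[nn0 qn].
have [V [G [[Vn uG fG1 fG2] iG cG]]] := construct n nn0.
have n_gt0 : (0 < n)%N by apply: leq_trans qn; rewrite addnS.
have nR0 : 0 < n%:R :> R by rewrite ltr0n.
have qn' : (q <= n)%N by apply: leq_trans qn; exact: leq_addr.
have rR0 : 0 < r%:R :> R by rewrite ltr0n ltnW.
have small : r%:R * (q%:R / n%:R) <= delta / 2.
  rewrite mulrA -natrM ler_pdivrMr//.
  have : 2 * (r * q)%:R / delta <= n%:R.
    by rewrite (le_trans (ltW (truncnS_gt _)))// ler_nat (leq_trans _ qn)// leq_addl.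
  by rewrite ler_pdivrMr//; lra.
rewrite /RT_ratio ler_pdivlMr ?exprn_gt0//.
apply: (@le_trans _ _ #|G|%:R); last by rewrite ler_nat; exact: RT_ge (HF _ _ fG1 fG2) iG.
apply: le_trans cG; rewrite -ler_pdivlMr ?exprn_gt0//.
have -> : ((n - q)%:R / r%:R) ^+ r * ((1 - eta) / 2) ^+ M / n%:R ^+ r =
   2 ^- M * r%:R ^- r * ((1 - q%:R / n%:R) ^+ r * (1 - eta) ^+ M) :> R.
  have -> : 1 - q%:R / n%:R = (n - q)%:R / n%:R :> R.
    by rewrite natrB// mulrBl divff// gt_eqF.
  by rewrite !exprMn !exprVn; ring.
set c := 2 ^- M * r%:R ^- r.
have c0 : 0 <= c by rewrite mulr_ge0 ?invr_ge0 ?exprn_ge0.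
have c1 : c <= 1.
  rewrite -[leRHS]mulr1 ler_pM ?invr_ge0 ?exprn_ge0// invf_le1 ?exprn_gt0// exprn_ege1//.
    by rewrite ler1n.
  by rewrite ler1n ltnW.
have q01 : 0 <= (q%:R / n%:R : R) <= 1.
  by apply/andP; split; [exact: divr_ge0|rewrite ler_pdivrMr// mul1r ler_nat].
have B1 := bernoulli_onem r q01.
have B2 : 1 - M%:R * eta <= (1 - eta) ^+ M by apply: bernoulli_onem; rewrite ltW.
apply: (@le_trans _ _ (c * (1 - delta))); first by nra.
rewrite ler_wpM2l//.
have b1 : 0 <= (1 - q%:R / n%:R : R) ^+ r <= 1.
  case/andP: q01 => ? ?; apply/andP; split; [apply: exprn_ge0|apply: exprn_ile1]; lra.
have b2 : 0 <= (1 - eta) ^+ M <= 1.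
  by apply/andP; split; [apply: exprn_ge0|apply: exprn_ile1]; lra.
move: ((1 - _) ^+ r) ((1 - eta) ^+ M) b1 b2 B1 B2 => p1 p2 /andP[? ?] /andP[? ?] B1 B2.
nra.
Qed.

(** Pairs among [u r] elements in [r] groups of size [u]: those across groups and those within
    one. *)
Lemma bin2_mul u r :
  'C(u * r, 2) = (u ^ 2 * 'C(r, 2) + r * 'C(u, 2))%N.
Proof.
have bin2M n : (2 * 'C(n, 2) = n * n.-1)%N by rewrite -mul_bin_diag bin1.
apply/eqP; rewrite -(eqn_pmul2l (isT : (0 < 2)%N)) mulnDr bin2M.
rewrite [(2 * (r * _))%N]mulnCA [(2 * (_ * _))%N]mulnCA !bin2M.
case: u => [|u]; first by rewrite !mul0n muln0.
case: r => [|r]; first by rewrite !muln0.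
by apply/eqP; rewrite -!subn1; nia.
Qed.

Theorem theorem2p4 (R : realType) (r : nat) (hr : (3 <= r)%N) :
  let u := uphalf r in
  let c : R := 2 ^ (- ('C(u * r, 2))%:Z + (r * 'C(u, 2))%:Z) * r%:R ^- r in
  (c%:E <= theta R r (TK_single r r.+2))%E /\
  (c%:E <= theta R r (TK_family r (2 * r)))%E.
Proof.
move=> u c.
have -> : c = 2 ^- (u ^ 2 * 'C(r, 2)) * r%:R ^- r.
  by rewrite /c bin2_mul PoszD opprD addrNK -exprnN.
have r1 : (1 < r)%N by exact: ltnW.
have u0 : (0 < u)%N by rewrite /u; lia.
(* [r <= 2 u <= 2^u], so [u] bits suffice to code the [r] vertices of an edge. *)
have ru : (r <= 2 ^ u)%N.
  apply: (@leq_trans (2 * u)); first by rewrite /u; lia.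
  by case: {c}u u0 => // v _; rewrite expnS leq_mul2l ltn_expl.
have free := RT_ratio_ge r1 u0 ru.
by split; apply: theta_ge => eps delta eps0 delta0; apply: free.
Qed.
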